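(* Let $W\in L^\infty(SM)$ be nonvanishing. Suppose that for every $\eta\in\mathbb R$ the weighted geodesic X-ray transform with weight $e^{i\eta s}W(\gamma_{x,v}(s),\dot\gamma_{x,v}(s))$ is injective on $C(\overline M)$, i.e. for $f\in C(\overline M)$, if $\int_0^{\tau(x,v)}e^{i\eta s}W(\gamma_{x,v}(s),\dot\gamma_{x,v}(s))f(\gamma_{x,v}(s))\,ds=0$ for a.e. $(x,v)\in\partial_-SM$, then $f=0$. Assume that $S\in L^\infty(\mathbb R\times M)\cap L^1(\mathbb R;C(\overline M))$. If $$L_WS(t,x,v):=\int_0^{\tau(x,v)}S(t+s,\gamma_{x,v}(s))W(\gamma_{x,v}(s),\dot\gamma_{x,v}(s))\,ds=0$$ for a.e. $(t,x,v)\in\mathbb R\times\partial_-SM$, then $S=0$.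
   Context: $M$ is the interior of a compact non-trapping Riemannian manifold $(\overline M,g)$ of dimension $n\ge2$ with smooth strictly convex boundary $\partial M$ (non-trapping: every maximal geodesic exits $\overline M$ in finite time). $SM=\{(x,v)\in TM:|v|_{g(x)}=1\}$; with $\nu$ the unit outer normal, $\partial_-SM=\{(x,v)\in S\overline M:x\in\partial M,\ \langle\nu(x),v\rangle_{g(x)}<0\}$. $\gamma_{x,v}$ is the geodesic with $\gamma_{x,v}(0)=x$, $\dot\gamma_{x,v}(0)=v$, and $\tau(x,v)$ is its forward exit time, $\gamma_{x,v}(\tau(x,v))\in\partial M$. *)

(* Defs.v *)
From HB Require Import structures.
From mathcomp Require Import all_boot all_order all_algebra.
From mathcomp Require Import all_classical all_reals all_analysis.
From mathcomp Require Import complex.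
Set Implicit Arguments.
Unset Strict Implicit.
Unset Printing Implicit Defensive.
Import Order.TTheory GRing.Theory Num.Theory.
Import numFieldNormedType.Exports.
Local Open Scope classical_set_scope.
Local Open Scope ring_scope.

(** * Lebesgue null sets of R^n *)

(* Lebesgue measure on Borel sets of R^n, as an iterated product (Tonelli).
   Only the null sets [(lebn R n).-negligible] are used below, i.e. subsets of
   Borel sets of measure zero; note that [negligible] is the library's notion
   for an arbitrary set function. *)
Fixpoint lebn (R : realType) (n : nat) :
    set (n.-tuple (measurableTypeR R)) -> \bar R :=
  match n return set (n.-tuple (measurableTypeR R)) -> \bar R with
  | 0 => fun A => (\d_([tuple] : 0.-tuple (measurableTypeR R)) A)%E
  | n'.+1 => fun A =>
      (@lebesgue_measure R \x @lebn R n')%E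
        [set p : measurableTypeR R * n'.-tuple (measurableTypeR R) |
           A [tuple of p.1 :: p.2]]
  end.

Definition rowt (R : realType) (n : nat)
    (z : n.-tuple (measurableTypeR R)) : 'rV[R]_n := \row_i tnth z i.

(** * Smooth functions, also up to the boundary of the half-space *)

Fixpoint Ck (R : realType) (n k : nat) (U : set 'rV[R]_n)
    (f : 'rV[R]_n -> R) : Prop :=
  (forall y, U y -> {for y, continuous f}) /\
  match k with
  | 0 => True
  | k'.+1 => forall v : 'rV[R]_n,
      (forall y, U y -> derivable f y v) /\ Ck k' U (fun y => 'D_v f y)
  end.

(* Smoothness on a set that need not be open: local smooth extendability. *)
Definition smooth_on (R : realType) (n : nat) (A : set 'rV[R]_n)
    (f : 'rV[R]_n -> R) : Prop :=
  forall y, A y -> exists (O : set 'rV[R]_n) (F : 'rV[R]_n -> R),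
    [/\ open O, O y, (forall k, Ck k O F) &
        forall z, O z -> A z -> f z = F z].

Definition half_space (R : realType) (m : nat) : set 'rV[R]_m.+1 :=
  [set y | 0 <= y 0 ord0].

(* Partial derivative along the half-space (one-sided in the direction [ord0]
   at points with [y 0 ord0 = 0]). *)
Definition dpart (R : realType) (m : nat) (a : 'I_m.+1)
    (f : 'rV[R]_m.+1 -> R) (y : 'rV[R]_m.+1) : R :=
  lim ((fun h : R => h^-1 * (f (y + h *: delta_mx 0 a) - f y))
         @ within [set h | half_space (y + h *: delta_mx 0 a)] 0^').

(* [l] is the derivative of [u] at [s] along [D]. *)
Definition deriv_on (R : realType) (n : nat) (D : set R) (u : R -> 'rV[R]_n)
    (s : R) (l : 'rV[R]_n) : Prop :=
  (fun h : R => h^-1 *: (u (s + h) - u s))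
    @ within [set h | D (s + h)] 0^' --> l.

(** * Compact manifolds with boundary, of dimension [m.+1] *)

(* The atlas takes values in the half-space [0 <= y_0]. It need not be maximal.
   [coord i] (resp. [coord_inv i]) is only meaningful on [dom i] (resp. on the
   image of [dom i]). Second countability follows from compactness. *)
Record cmanifold (R : realType) (m : nat) := CManifold {
  mpt :> topologicalType ;
  m_hausdorff : hausdorff_space mpt ;
  m_compact : compact [set: mpt] ;
  idx : Type ;
  dom : idx -> set mpt ;
  coord : idx -> mpt -> 'rV[R]_m.+1 ;
  coord_inv : idx -> 'rV[R]_m.+1 -> mpt ;
  dom_open : forall i, open (dom i) ;
  dom_cover : forall x, exists i, dom i x ;
  coordK : forall i x, dom i x -> coord_inv i (coord i x) = x ;
  coord_image_open : forall i, exists2 O : set 'rV[R]_m.+1,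
    open O & coord i @` dom i = O `&` @half_space R m ;
  coord_continuous : forall i x, dom i x -> {for x, continuous (coord i)} ;
  coord_inv_continuous : forall i,
    {within coord i @` dom i, continuous (coord_inv i)} ;
  transition_smooth : forall (i j : idx) (l : 'I_m.+1),
    smooth_on (coord i @` (dom i `&` dom j))
      (fun y => coord j (coord_inv i y) 0 l)
}.

Section Manifold.
Context {R : realType} {m : nat} (M : cmanifold R m).

Definition chart_im (i : idx M) : set 'rV[R]_m.+1 := coord i @` dom i.

Definition bdry : set M := [set x | exists2 i, dom i x & coord i x 0 ord0 = 0].

Definition jac (i j : idx M) (y : 'rV[R]_m.+1) : 'M[R]_m.+1 :=
  \matrix_(k, l) dpart k (fun z => coord j (coord_inv i z) 0 l) y.

(* A tangent vector at [x] is the family of its components in all charts around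
   [x], subject to the contravariant transformation law; the components in the
   other charts are set to [0]. *)
Definition tvec : Type := idx M -> 'rV[R]_m.+1.

Definition tangent (z : M * tvec) : Prop :=
  (forall i j, dom i z.1 -> dom j z.1 ->
     z.2 j = z.2 i *m jac i j (coord i z.1)) /\
  (forall i, ~ dom i z.1 -> z.2 i = 0).

(* The point of TM with coordinates [(y, v)] in the chart [i]. *)
Definition lift_tangent (i : idx M) (y v : 'rV[R]_m.+1) : M * tvec :=
  (coord_inv i y,
   fun j => if `[< dom j (coord_inv i y) >] then v *m jac i j y else 0).

End Manifold.

Record riemannian (R : realType) (m : nat) (M : cmanifold R m) := Riemannian {
  gm :> idx M -> 'rV[R]_m.+1 -> 'M[R]_m.+1 ;
  gm_sym : forall i y, chart_im i y -> (gm i y)^T = gm i y ;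
  gm_pos : forall i y (v : 'rV[R]_m.+1), chart_im i y -> v != 0 ->
    0 < (v *m gm i y *m v^T) 0 0 ;
  gm_smooth : forall i (k l : 'I_m.+1),
    smooth_on (chart_im i) (fun y => gm i y k l) ;
  gm_change : forall i j x, dom i x -> dom j x ->
    gm i (coord i x) =
      jac i j (coord i x) *m gm j (coord j x) *m (jac i j (coord i x))^T
}.

Section Riemannian.
Context {R : realType} {m : nat} {M : cmanifold R m} (g : riemannian M).

Definition gdot (i : idx M) (y v w : 'rV[R]_m.+1) : R :=
  (v *m g i y *m w^T) 0 0.

Definition christoffel (i : idx M) (y : 'rV[R]_m.+1) (k a b : 'I_m.+1) : R :=
  2^-1 * \sum_l invmx (g i y) k l *
    (dpart a (fun z => g i z l b) y + dpart b (fun z => g i z l a) y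
     - dpart l (fun z => g i z a b) y).

(* The unit sphere bundle of the compact manifold (boundary included). *)
Definition sphere_bundle : set (M * tvec M) :=
  [set z | tangent z /\
     forall i, dom i z.1 -> gdot i (coord i z.1) (z.2 i) (z.2 i) = 1].

(* Unit outer normal to the level sets of the boundary defining function [y_0];
   it is minus the normalized gradient of [y_0]. *)
Definition normal (i : idx M) (y : 'rV[R]_m.+1) : 'rV[R]_m.+1 :=
  - (Num.sqrt (invmx (g i y) 0 0))^-1 *: row 0 (invmx (g i y)).

Definition cov_normal (i : idx M) (y v : 'rV[R]_m.+1) : 'rV[R]_m.+1 :=
  \row_k (\sum_a v 0 a * dpart a (fun z => normal i z 0 k) y +
          \sum_a \sum_b christoffel i y k a b * v 0 a * normal i y 0 b).

(* The second fundamental form <nabla_v nu, w> of the boundary is positive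
   definite; tangent vectors to the boundary are those with [v_0 = 0]. *)
Definition strictly_convex_boundary : Prop :=
  forall i y (v : 'rV[R]_m.+1),
    chart_im i y -> y 0 ord0 = 0 -> v 0 ord0 = 0 -> v != 0 ->
    0 < gdot i y (cov_normal i y v) v.

(** ** Geodesics *)

(* [c s] is the pair (gamma(s), gamma'(s)). *)
Definition geodesic (D : set R) (c : R -> M * tvec M) : Prop :=
  [/\ (forall s, D s -> tangent (c s)),
      {within D, continuous (fun s => (c s).1 : M)} &
      forall i s, D s -> dom i (c s).1 ->
        let y := coord i (c s).1 in let v := (c s).2 i in
        deriv_on D (fun r => coord i (c r).1) s v /\
        deriv_on D (fun r => (c r).2 i) s
          (\row_k (- \sum_a \sum_b christoffel i y k a b * v 0 a * v 0 b))].

Definition unit_geodesic (D : set R) (c : R -> M * tvec M) : Prop :=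
  geodesic D c /\ forall s, D s -> sphere_bundle (c s).

Definition maximal_geodesic (D : set R) (c : R -> M * tvec M) : Prop :=
  [/\ D !=set0, is_interval D, unit_geodesic D c &
      forall D' c', is_interval D' -> D `<=` D' -> unit_geodesic D' c' ->
        (forall s, D s -> c' s = c s) -> D' = D].

Definition non_trapping : Prop :=
  forall D c, maximal_geodesic D c -> exists K : R, forall s, D s -> `|s| <= K.

(** ** The inward boundary and the maximal geodesics issued from it *)

Definition inward : set (M * tvec M) :=
  [set z | [/\ sphere_bundle z, bdry z.1 &
     forall i, dom i z.1 ->
       gdot i (coord i z.1) (normal i (coord i z.1)) (z.2 i) < 0]].

(* The pair (tau(x,v), s |-> (gamma_{x,v}(s), gamma_{x,v}'(s))); a maximal
   geodesic issued from an inward vector is defined on [0, tau(x,v)]. The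
   default value of [xget] is irrelevant for [z] in [inward], by the local
   theory of ordinary differential equations. *)
Definition exit_pair (z : M * tvec M) : R * (R -> M * tvec M) :=
  xget (0, fun=> z)
    [set p | [/\ 0 <= p.1, maximal_geodesic `[0, p.1] p.2, p.2 0 = z &
                 bdry (p.2 p.1).1]].

Definition exit_time (z : M * tvec M) : R := (exit_pair z).1.

Definition flow (z : M * tvec M) (s : R) : M * tvec M := (exit_pair z).2 s.

(** ** Almost everywhere *)

(* All measures involved (Riemannian volume, Liouville measure, their boundary
   analogues) have smooth positive densities in charts, so that null sets are
   those that are Lebesgue null in every chart. For sets of unit vectors we use
   the cone measure: [A] is null iff the cone {r v | r > 0, v in A} is. *)

Definition unit_lift (i : idx M) (y v : 'rV[R]_m.+1) : M * tvec M :=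
  lift_tangent i y ((Num.sqrt (gdot i y v v))^-1 *: v).

(* a.e. (t, x) in R x M, M being the interior *)
Definition ae_time_interior (P : R -> M -> Prop) : Prop :=
  forall i, (@lebn R m.+2).-negligible
    [set z : m.+2.-tuple (measurableTypeR R) |
       let y := rowt [tuple of behead z] in
       [/\ chart_im i y, 0 < y 0 ord0 & ~ P (thead z) (coord_inv i y)]].

(* a.e. (x, v) in SM, M being the interior *)
Definition ae_sphere_bundle (P : M * tvec M -> Prop) : Prop :=
  forall i, (@lebn R (m.+1 + m.+1)).-negligible
    [set z : (m.+1 + m.+1).-tuple (measurableTypeR R) |
       let y := lsubmx (rowt z) in let v := rsubmx (rowt z) in
       [/\ chart_im i y, 0 < y 0 ord0, v != 0 & ~ P (unit_lift i y v)]].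

(* [z = (y', v)] where [(0, y')] are the coordinates of the base point and [v]
   those of a (not necessarily unit) inward pointing vector. *)
Definition bdry_coord (z : 'rV[R]_(m + m.+1)) : 'rV[R]_m.+1 :=
  row_mx (0 : 'rV_1) (lsubmx z).

Definition inward_chart (i : idx M) (z : 'rV[R]_(m + m.+1)) : Prop :=
  chart_im i (bdry_coord z) /\
  gdot i (bdry_coord z) (normal i (bdry_coord z)) (rsubmx z) < 0.

Definition inward_lift (i : idx M) (z : 'rV[R]_(m + m.+1)) : M * tvec M :=
  unit_lift i (bdry_coord z) (rsubmx z).

Definition ae_inward (P : M * tvec M -> Prop) : Prop :=
  forall i, (@lebn R (m + m.+1)).-negligible
    [set z : (m + m.+1).-tuple (measurableTypeR R) |
       inward_chart i (rowt z) /\ ~ P (inward_lift i (rowt z))].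

(* a.e. (t, (x, v)) in R x (inward boundary) *)
Definition ae_time_inward (P : R -> M * tvec M -> Prop) : Prop :=
  forall i, (@lebn R (m + m.+1).+1).-negligible
    [set z : (m + m.+1).+1.-tuple (measurableTypeR R) |
       let z' := rowt [tuple of behead z] in
       inward_chart i z' /\ ~ P (thead z) (inward_lift i z')].

(** ** Function spaces *)

(* An element of L^oo(SM), given by a bounded Borel representative; since the
   vectors based at the boundary form a null set, the representative is taken
   on all of [sphere_bundle]. Every class has such a representative, and the
   ray transforms of two representatives agree almost everywhere. *)
Definition Linfty_sphere_bundle (W : M * tvec M -> R[i]) : Prop :=
  (exists C : R, forall z, sphere_bundle z -> ComplexField.Normc.normc (W z) <= C) /\
  forall i,
    let D := [set z : (m.+1 + m.+1).-tuple (measurableTypeR R) |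
      let y := lsubmx (rowt z) in let v := rsubmx (rowt z) in
      chart_im i y /\ gdot i y v v = 1] in
    let Wi z := W (lift_tangent i (lsubmx (rowt z)) (rsubmx (rowt z))) in
    measurable_fun D (fun z => complex.Re (Wi z) : measurableTypeR R) /\
    measurable_fun D (fun z => complex.Im (Wi z) : measurableTypeR R).

End Riemannian.

Definition ccontinuous (R : realType) (T : topologicalType)
    (f : T -> R[i]) : Prop :=
  continuous (fun x => complex.Re (f x) : R) /\ continuous (fun x => complex.Im (f x) : R).

Definition supnorm (R : realType) (T : Type) (f : T -> R[i]) : \bar R :=
  ereal_sup [set (ComplexField.Normc.normc (f x))%:E | x in [set: T]].

(* The simple function t |-> sum_p 1_{p.1}(t) p.2 *)
Definition simple_val (R : realType) (T : Type)
    (s : seq (set (measurableTypeR R) * (T -> R[i]))) (t : R) (x : T) : R[i] :=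
  \sum_(p <- s) (\1_(p.1) t : R)%:C%C * p.2 x.

(* Bochner space L^1(R; C(T)) for a compact [T]: strongly measurable functions
   with integrable norm. An almost everywhere limit of simple functions agrees
   almost everywhere with a pointwise one, so the representative is taken to be
   a pointwise limit. *)
Definition Bochner_L1 (R : realType) (T : topologicalType)
    (S : R -> T -> R[i]) : Prop :=
  [/\ (forall t, ccontinuous (S t)),
      (exists s : nat -> seq (set (measurableTypeR R) * (T -> R[i])),
         (forall k, forall j, (j < size (s k))%N ->
            let p := nth (set0, fun=> 0) (s k) j in
            [/\ measurable p.1, (@lebesgue_measure R p.1 < +oo)%E &
                ccontinuous p.2]) /\
         (forall t, (fun k => supnorm (fun x => S t x - simple_val (s k) t x))
                      @ \oo --> (0 : \bar R))) &
      (\int[@lebesgue_measure R]_t supnorm (S t) < +oo)%E].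

Definition cintegral (R : realType) (D : set R) (h : R -> R[i]) : R[i] :=
  (Rintegral (@lebesgue_measure R) D (fun s => complex.Re (h s)) +i*
   Rintegral (@lebesgue_measure R) D (fun s => complex.Im (h s)))%C.

Definition cis (R : realType) (a : R) : R[i] := (cos a +i* sin a)%C.

Section Transforms.
Context {R : realType} {m : nat} {M : cmanifold R m} (g : riemannian M).

Definition xray (w : M * tvec M -> R -> R[i]) (f : M -> R[i])
    (z : M * tvec M) : R[i] :=
  cintegral `[0, exit_time g z] (fun s => w z s * f (flow g z s).1).

(* The weight e^{i eta s} W(gamma_{x,v}(s), gamma_{x,v}'(s)) *)
Definition exp_weight (W : M * tvec M -> R[i]) (eta : R)
    (z : M * tvec M) (s : R) : R[i] :=
  cis (eta * s) * W (flow g z s).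

Definition xray_injective (w : M * tvec M -> R -> R[i]) : Prop :=
  forall f : M -> R[i], ccontinuous f ->
    ae_inward g (fun z => xray w f z = 0) -> forall x, f x = 0.

Definition LW (W : M * tvec M -> R[i]) (S : R -> M -> R[i])
    (t : R) (z : M * tvec M) : R[i] :=
  cintegral `[0, exit_time g z]
    (fun s => S (t + s) (flow g z s).1 * W (flow g z s)).

End Transforms.

(* Main.v *)
(** Taking the Fourier transform in time of [LW g W S t z = 0] and applying Fubini
    turns the light ray transform into the weighted geodesic transform, with weight
    [e^{i eta s} W], of the function [x |-> \int e^{-i eta t} S(t, x) dt], which is
    continuous by dominated convergence. Injectivity for every [eta] kills all these
    Fourier coefficients; uniqueness for the Fourier transform on L^1(R), applied at
    the points of a countable dense subset of [M], then gives [S = 0]. Since the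
    geodesics are part of the data of the transforms, no differential equation has
    to be solved: where [exit_pair] takes its default value both transforms vanish. *)
From HB Require Import structures.
From mathcomp Require Import all_boot all_order all_algebra.
From mathcomp Require Import all_classical all_reals all_analysis.
From mathcomp Require finmap.
From mathcomp Require Import measurable_realfun complex ring lra.
Require Import Defs.
Import Order.TTheory GRing.Theory Num.Theory.
Import numFieldNormedType.Exports.
Local Open Scope classical_set_scope.
Local Open Scope ring_scope.

(** * Uniqueness for the Fourier transform of real integrable functions *)

(** Fourier uniqueness is obtained here without inversion or approximate identities. Vanishing
    coefficients make [u] orthogonal to all trigonometric polynomials, bounded pointwise limits of
    these reach the indicators of bounded intervals, and Lebesgue differentiation of the resulting
    zero primitives gives [u = 0] almost everywhere. Exceptional sets are handled by Tonelli in
    charts: a null set of pairs (t, z) becomes, for almost every z, a null set of times t. Such a z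
    then serves every eta at once. The delicate hypothesis of Fubini is joint measurability in (t,
    s) of S(t + s, gamma(s)) W(gamma(s), gamma'(s)), since M carries no sigma-algebra and W is Borel
    only in charts. S is reached through its approximating simple functions, W by cutting the
    geodesic into countably many measurable sets of times, each spent in one chart. The integrand is
    dominated by C 1_[0, tau](s) |S(t + s)|, with the sup norm in x and C a bound of W; the integral
    of the norm over t does not depend on s. *)

Section steps.
Context {R : realType}.
Implicit Types x y r : R.

Lemma bernoulli_ineq y n : -1 <= y -> 1 + n%:R * y <= (1 + y) ^+ n.
Proof.
move=> y1; elim: n => [|n IH]; first by rewrite mul0r addr0 expr0.
rewrite exprS; have h : 0 <= 1 + y by lra.
apply: le_trans (ler_wpM2l h IH).
have n0 : (0 : R) <= n%:R by [].
rewrite -natr1; nra.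
Qed.

(** With r = s^2, the Bernoulli inequality for 1/s bounds n s^n by 1 / (1/s - 1); the remaining
    factor s^n is geometric. *)
Lemma cvg_natmul_expr r : 0 <= r -> r < 1 ->
  (fun n => n%:R * r ^+ n) @ \oo --> (0 : R).
Proof.
rewrite le_eqVlt => /predU1P[<- _|r0 r1].
  under eq_fun do rewrite expr0n mulrnAr mulr1.
  apply: (@cvg_trans _ ((fun=> 0 : R) @ \oo)); last exact: cvg_cst.
  by apply: near_eq_cvg; exists 1%N => // -[|n] //= _; rewrite mulr0n.
set s := Num.sqrt r; have s0 : 0 < s by rewrite sqrtr_gt0.
have rE : r = s * s by rewrite -expr2 sqr_sqrtr// ltW.
have s1 : s < 1 by rewrite ltNge; apply/negP => h; nra.
have K0 : 0 < s^-1 - 1 by rewrite subr_gt0 invf_gt1.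
apply: (@squeeze_cvgr _ _ _ _ (fun=> 0) (geometric (s^-1 - 1)^-1 s)).
- apply: nearW => n; rewrite mulr_ge0 ?exprn_ge0 ?(ltW r0)//=.
  rewrite rE exprMn mulrA ler_pM2r ?exprn_gt0//.
  have : 1 + n%:R * (s^-1 - 1) <= (1 + (s^-1 - 1)) ^+ n by apply: bernoulli_ineq; lra.
  rewrite [in leRHS]addrC subrK.
  rewrite exprVn => h.
  rewrite -(@ler_pM2r _ ((s^-1 - 1)))// mulrAC mulVf ?gt_eqF//.
  have := @mulVf _ (s ^+ n); rewrite gt_eqF ?exprn_gt0// => /(_ isT).
  have : 0 < s ^+ n by rewrite exprn_gt0.
  nra.
- exact: cvg_cst.
- by apply: cvg_geometric; rewrite gtr0_norm.
Unshelve. all: by end_near. Qed.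

(* These polynomials are bounded by 1 on [0, 1] and converge there to the
   indicator of [1/2, 1]. Evaluated at a trigonometric polynomial, they are
   trigonometric polynomials converging boundedly to the indicator of a periodic
   set. The exponent [n * 2 ^ n], not [2 ^ n], gives the value 1 at 1/2. *)
Definition step_poly n x := 1 - (1 - x ^+ n) ^+ (n * 2 ^ n).

Lemma step_poly_bounds n x : 0 <= x <= 1 -> 0 <= step_poly n x <= 1.
Proof.
move=> /andP[x0 x1]; have xn := exprn_ile1 n x0 x1; have xn0 := exprn_ge0 n x0.
have h0 : 0 <= 1 - x ^+ n by lra.
have h1 : 1 - x ^+ n <= 1 by lra.
have := exprn_ile1 (n * 2 ^ n) h0 h1; have := exprn_ge0 (n * 2 ^ n) h0.
rewrite /step_poly; lra.
Qed.

(** Put N = n 2^n, so that N x^n = n (2x)^n. If x >= 1/2, then (1 - x^n)^N <= (1 + x^n)^(-N) <= 1 /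
    (1 + N x^n) <= 1 / (n + 1). If x < 1/2, Bernoulli bounds the polynomial by N x^n, which tends to
    0. *)
Lemma cvg_step_poly x : 0 <= x <= 1 ->
  step_poly n x @[n --> \oo] --> (if 2^-1 <= x then 1 else 0 : R).
Proof.
move=> x01; have /andP[x0 x1] := x01.
have NE n : (n * 2 ^ n)%:R * x ^+ n = n%:R * (2 * x) ^+ n :> R.
  by rewrite natrM natrX exprMn mulrA.
case: ifPn => [hx|]; last rewrite -ltNge => hx.
- rewrite -[X in _ --> X]subr0; apply: cvgB; first exact: cvg_cst.
  apply: (@squeeze_cvgr _ _ _ _ (fun=> 0) (@harmonic R)).
  + apply: nearW => n; have xn := exprn_ile1 n x0 x1; have xn0 := exprn_ge0 n x0.
    have h0 : 0 <= 1 - x ^+ n by lra.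
    rewrite exprn_ge0//=.
    have := @bernoulli_ineq (x ^+ n) (n * 2 ^ n) (le_trans (lerN10 R) xn0).
    rewrite NE => b.
    have c : 1 <= (2 * x) ^+ n by rewrite exprn_ege1//; lra.
    have n0 : (0 : R) <= n%:R by [].
    have d : n.+1%:R <= (1 + x ^+ n) ^+ (n * 2 ^ n).
      by apply: le_trans b; rewrite -natr1; nra.
    have e : (1 - x ^+ n) ^+ (n * 2 ^ n) * (1 + x ^+ n) ^+ (n * 2 ^ n) <= 1.
      by rewrite -exprMn exprn_ile1//; nra.
    rewrite -[leRHS]mul1r ler_pdivlMr//.
    by apply: le_trans e; rewrite ler_wpM2l// exprn_ge0.
  + exact: cvg_cst.
  + exact: cvg_harmonic.
- apply: (@squeeze_cvgr _ _ _ _ (fun=> 0) (fun n => n%:R * (2 * x) ^+ n)).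
  + apply: nearW => n; have /andP[-> _]/= := step_poly_bounds n _ x01.
    have xn := exprn_ile1 n x0 x1.
    have : 1 + (n * 2 ^ n)%:R * - x ^+ n <= (1 - x ^+ n) ^+ (n * 2 ^ n).
      by apply: bernoulli_ineq; lra.
    rewrite mulrN NE /step_poly; lra.
  + exact: cvg_cst.
  + by apply: cvg_natmul_expr; lra.
Qed.

End steps.

(** * Trigonometric polynomials with arbitrary real frequencies *)

Section trig.
Context {R : realType}.

(** The phase [b] covers sines as well, so that a single base case suffices in inductions. *)
Inductive trig : (R -> R) -> Prop :=
| trig_cos a b : trig (fun t => cos (a * t + b))
| trig_add f g : trig f -> trig g -> trig (fun t => f t + g t)
| trig_scale c f : trig f -> trig (fun t => c * f t).

Lemma trig_ext f g : f =1 g -> trig g -> trig f.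
Proof. by move=> /funext ->. Qed.

(** The base case is the product-to-sum formula. Closure under products is what allows [step_poly]
    to be evaluated at a trigonometric polynomial. *)
Lemma trig_mul f g : trig f -> trig g -> trig (fun t => f t * g t).
Proof.
move=> tf; elim: tf g => {f} [a b|f1 f2 _ IH1 _ IH2|c f _ IH] g tg.
- elim: tg => {g} [a' b'|g1 g2 _ IH1 _ IH2|c g _ IH].
  + rewrite (_ : (fun t => _) = fun t =>
      2^-1 * (cos ((a + a') * t + (b + b')) + cos ((a - a') * t + (b - b')))).
      by apply: trig_scale; apply: trig_add; exact: trig_cos.
    apply/funext => t.
    rewrite (_ : (a + a') * t + _ = (a * t + b) + (a' * t + b')); last by ring.
    rewrite (_ : (a - a') * t + _ = (a * t + b) - (a' * t + b')); last by ring.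
    set x := a * t + b; set y := a' * t + b'; by rewrite cosB (cosD x y); field.
  + by apply: trig_ext (trig_add _ _ IH1 IH2) => t; rewrite mulrDr.
  + by apply: trig_ext (trig_scale c _ IH) => t; rewrite mulrCA.
- by apply: trig_ext (trig_add _ _ (IH1 _ tg) (IH2 _ tg)) => t; rewrite mulrDl.
- by apply: trig_ext (trig_scale c _ (IH _ tg)) => t; rewrite mulrA.
Qed.

Lemma trig_cst c : trig (fun=> c).
Proof.
rewrite (_ : (fun=> c) = fun t => c * cos (0 * t + 0)).
  by apply: trig_scale; exact: trig_cos.
by apply/funext => t; rewrite mul0r add0r cos0 mulr1.
Qed.

Lemma trigX f n : trig f -> trig (fun t => f t ^+ n).
Proof.
move=> tf; elim: n => [|n IH]; first exact: trig_ext (trig_cst 1).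
by apply: trig_ext (trig_mul _ _ tf IH) => t; rewrite exprS.
Qed.

Lemma trig_step_poly f n : trig f -> trig (fun t => step_poly n (f t)).
Proof.
have trigB1 h : trig h -> trig (fun t => 1 - h t).
  move=> th; apply: trig_add; first exact: trig_cst.
  by apply: trig_ext (trig_scale (-1) _ th) => t; rewrite mulN1r.
by move=> tf; exact: (trigB1 _ (trigX _ _ (trigB1 _ (trigX _ _ tf)))).
Qed.

Lemma trig_continuous f : trig f -> continuous f.
Proof.
elim=> {f} [a b|f g _ cf _ cg|c f _ cf] t.
- apply: (@continuous_comp _ _ _ (fun t => a * t + b) cos); last exact: continuous_cos.
  by apply: cvgD; [apply: cvgZr; exact: cvg_id|exact: cvg_cst].
- by apply: cvgD; [exact: cf|exact: cg].
- by apply: cvgZr; exact: cf.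
Qed.

Lemma trig_bounded f : trig f -> exists C, forall t, `|f t| <= C.
Proof.
elim=> {f} [a b|f g _ [C hC] _ [D hD]|c f _ [C hC]].
- by exists 1 => t; exact: cos_max.
- by exists (C + D) => t; rewrite (le_trans (ler_normD _ _))// lerD.
- by exists (`|c| * C) => t; rewrite normrM ler_wpM2l.
Qed.

End trig.

(** * From vanishing cosine and sine integrals to vanishing almost everywhere *)

Section fourier.
Context {R : realType}.
Notation mu := (@lebesgue_measure R).
Variable u : R -> R.
Hypothesis iu : mu.-integrable setT (EFin \o u).
Hypothesis cos0u : forall a, (\int[mu]_(t in setT) (cos (a * t) * u t) = 0)%R.
Hypothesis sin0u : forall a, (\int[mu]_(t in setT) (sin (a * t) * u t) = 0)%R.

Let integ (f : R -> R) C : measurable_fun setT f -> (forall t, `|f t| <= C) ->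
  mu.-integrable setT (EFin \o (fun t => f t * u t)).
Proof.
move=> mf bf.
rewrite (_ : EFin \o _ = ((EFin \o f) \* (EFin \o u))%E); last first.
  by apply/funext => t /=; rewrite EFinM.
apply: integrableMr => //.
by exists C; split; [exact: num_real|move=> x Cx t _; exact: le_trans (bf t) (ltW Cx)].
Qed.

Let trig_integ f : trig f -> mu.-integrable setT (EFin \o (fun t => f t * u t)).
Proof.
move=> tf; have [C hC] := trig_bounded f tf.
by apply: (integ f C) => //; exact: continuous_measurable_fun (trig_continuous _ tf).
Qed.

Let trig0 f : trig f -> (\int[mu]_(t in setT) (f t * u t) = 0)%R.
Proof.
elim=> {f} [a b|f g tf If tg Ig|c f tf If].
- pose v t := cos b * (cos (a * t) * u t) - sin b * (sin (a * t) * u t).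
  have E t : cos (a * t + b) * u t = v t by rewrite cosD /v; ring.
  have mc : mu.-integrable setT (EFin \o (fun t => cos (a * t) * u t)).
    have := trig_integ _ (trig_cos a 0); apply: eq_integrable => // t _ /=.
    by rewrite addr0.
  have ms : mu.-integrable setT (EFin \o (fun t => sin (a * t) * u t)).
    have := trig_integ _ (trig_cos a (- (pi / 2))); apply: eq_integrable => // t _ /=.
    by rewrite cosBpihalf.
  rewrite (@eq_Rintegral _ _ _ mu setT v); last by move=> t _; exact: E.
  have iZ c h : mu.-integrable setT (EFin \o h) ->
      mu.-integrable setT (EFin \o (fun t : R => c * h t)).
    by move=> ih; exact: (@integrableZl _ _ _ mu _ measurableT c _ ih).
  rewrite RintegralB//; [|exact: iZ..].
  by rewrite !RintegralZl// cos0u sin0u !mulr0 subrr.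
- rewrite (@eq_Rintegral _ _ _ mu setT (fun t => f t * u t + g t * u t)); last first.
    by move=> t _; rewrite mulrDl.
  by rewrite RintegralD//; [rewrite If Ig addr0|exact: trig_integ..].
- rewrite (@eq_Rintegral _ _ _ mu setT (fun t => c * (f t * u t))); last first.
    by move=> t _; rewrite mulrA.
  by rewrite RintegralZl//; [rewrite If mulr0|exact: trig_integ].
Qed.

(** Dominated convergence with majorant C |u|. It serves twice: from trigonometric polynomials to
    periodic indicators, then from these to the indicator of an interval. *)
Let lim0 (f_ : nat -> R -> R) (f : R -> R) C :
  (forall n, measurable_fun setT (f_ n)) ->
  (forall n t, `|f_ n t| <= C) -> (forall t, f_ ^~ t @ \oo --> f t) ->
  (forall n, \int[mu]_(t in setT) (f_ n t * u t) = 0)%R ->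
  (\int[mu]_(t in setT) (f t * u t) = 0)%R.
Proof.
move=> mf bf ff f0.
have mlim : measurable_fun setT f.
  by apply: (@measurable_fun_cvg _ _ _ _ f_) => // t _; exact: ff.
have mu_ : measurable_fun setT u by apply/measurable_EFinP; exact: measurable_int iu.
have [|||||_ _] := @dominated_convergence _ _ _ mu setT measurableT
  (fun n t => (f_ n t * u t)%:E) (fun t => (f t * u t)%:E) (fun t => (C * `|u t|)%:E).
- move=> n; apply/measurable_EFinP; exact: (measurable_funM (mf n) mu_).
- apply/measurable_EFinP; exact: (measurable_funM mlim mu_).
- apply: aeW => t _; apply: cvg_EFin; first exact: nearW.
  by apply: cvgM; [exact: ff|exact: cvg_cst].
- apply: (@integrableZl _ _ _ mu _ measurableT C (fun t => `|u t|%:E)).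
  exact: (integrable_abse iu).
- apply: aeW => t n _; rewrite /= lee_fin normrM ler_wpM2r//.
- have E : (fun n => \int[mu]_t (f_ n t * u t)%:E)%E = fun=> 0%E.
    apply/funext => n /=.
    rewrite -[LHS]fineK; last exact: integrable_fin_num (integ _ _ (mf n) (bf n)).
    by congr EFin; exact: f0.
  rewrite /= E => H; rewrite /Rintegral (_ : (\int[mu]_t _)%E = 0%E)//.
  by apply: (cvg_unique (@ereal_hausdorff _) H); exact: cvg_cst.
Qed.

(** The periodic indicator [E k] is a bounded limit of trigonometric polynomials. As its period
    grows with [k], only the copy of the interval around [c] survives at any fixed point. *)
Let itv0 c d : 0 <= d -> (\int[mu]_(t in `[(c - d), (c + d)]) u t = 0)%R.
Proof.
move=> d0; rewrite Rintegral_mkcond.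
(* [p k t >= 1/2] says that [t] lies within [d] of [c], up to the period
   [2 * pi * (k + 1)] of [p k]. *)
pose E k := fun t : R =>
  if cos (d / k.+1%:R) <= cos (k.+1%:R^-1 * t - c / k.+1%:R) then 1 else 0 : R.
pose p k := fun t : R =>
  2^-1 + 4^-1 * (cos (k.+1%:R^-1 * t - c / k.+1%:R) - cos (d / k.+1%:R)).
(* A difference of two cosines lies in [-2, 2]; the factor 1/4 brings it into [-1/2, 1/2], and the
   shift puts the threshold at 1/2. *)
have p01 k t : 0 <= p k t <= 1.
  rewrite /p; set a := cos (_ - _); set b := cos _.
  have : -1 <= a <= 1 by rewrite cos_geN1 cos_le1.
  have : -1 <= b <= 1 by rewrite cos_geN1 cos_le1.
  by lra.
have tp k : trig (p k).
  apply: trig_add; first exact: trig_cst.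
  by apply/trig_scale/trig_add; [exact: trig_cos|exact: trig_cst].
have pE k t : step_poly n (p k t) @[n --> \oo] --> E k t.
  have := cvg_step_poly _ (p01 k t); congr (_ --> _); rewrite /E.
  by congr (if _ then _ else _); rewrite /p; apply/idP/idP => h; lra.
have mpk k n : measurable_fun setT (fun t => step_poly n (p k t)).
  exact: continuous_measurable_fun (trig_continuous _ (trig_step_poly _ n (tp k))).
have E0 k : (\int[mu]_(t in setT) (E k t * u t) = 0)%R.
  apply: (lim0 (fun n t => step_poly n (p k t)) (E k) 1) => // n.
  - by move=> t; have /andP[? ?] := step_poly_bounds n _ (p01 k t); rewrite ger0_norm.
  - exact/trig0/trig_step_poly.
have -> : u \_ `[(c - d), (c + d)] = fun t => \1_(`[c - d, c + d]%classic) t * u t.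
  apply/funext => t; rewrite patchE indicE; case: ifPn => _; by rewrite ?mul1r ?mul0r.
apply: (lim0 E _ 1) => //.
- move=> k; apply: (@measurable_fun_cvg _ _ _ _ (fun n t => step_poly n (p k t))) => //.
- by move=> k t; rewrite /E; case: ifPn => _; rewrite ?normr1 ?normr0.
- move=> t; apply: (@cvg_trans _ ((fun=> \1_(`[c - d, c + d]%classic) t : R) @ \oo));
    last exact: cvg_cst.
  (* Once [k] exceeds [d] and |t - c|, both angles lie in [0, pi], where the cosine decreases;
     comparing the cosines then amounts to |t - c| <= d. *)
  apply: near_eq_cvg; near=> k.
  rewrite /E indicE.
  rewrite [LHS](_ : _ = if (t \in `[c - d, c + d]%classic) then 1 else 0);
    last by case: (_ \in _).
  congr (if _ then _ else _).
  have k0 : (0 : R) < k.+1%:R by [].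
  have kd : d / k.+1%:R \in `[0, pi].
    rewrite in_itv/= divr_ge0//= ler_pdivrMr//.
    have : d <= k%:R by near: k; exact: nbhs_infty_ger.
    have := @pi_ge2 R; rewrite -natr1; nra.
  rewrite -(cos_norm (k.+1%:R^-1 * t - _)).
  have -> : k.+1%:R^-1 * t - c / k.+1%:R = (t - c) / k.+1%:R by ring.
  rewrite normrM (gtr0_norm (x := _^-1)) ?invr_gt0//.
  have kt : `|t - c| / k.+1%:R \in `[0, pi].
    rewrite in_itv/= divr_ge0//= ler_pdivrMr//.
    have : `|t - c| <= k%:R by near: k; exact: nbhs_infty_ger.
    have := @pi_ge2 R; rewrite -natr1; have := normr_ge0 (t - c); nra.
  rewrite leNgt ltr_cos// -leNgt ler_pM2r ?invr_gt0//.
  apply/idP/idP; rewrite inE/= in_itv/=.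
    by rewrite ler_distl.
  by rewrite ler_distl.
Unshelve. all: by end_near. Qed.

(** [itv0] concerns bounded intervals only, so primitives are taken from the base points -n. Each
    vanishes identically, and differentiating it gives the claim on ]-n, +oo[. *)
Theorem fourier_unique_real : {ae mu, forall t, u t = 0}.
Proof.
have iuD D : measurable D -> mu.-integrable D (EFin \o u).
  by move=> mD; exact: integrableS iu.
have lu : locally_integrable setT u by apply: open_integrable_locally => //; exact: openT.
have H n : {ae mu, forall t, - n%:R < t -> u t = 0}.
  have := @FTC1 R u (BLeft (- n%:R)) _ lu.
  have F0 : (fun x : R =>
      (\int[mu]_(t in [set` Interval (BLeft (- n%:R)) (BRight x)]) u t)%R) = fun=> 0.
    apply/funext => x; have [xn|nx] := ltP x (- n%:R).
      by rewrite set_itv_ge ?Rintegral_set0// bnd_simp -ltNge.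
    have := itv0 ((x - n%:R) / 2) ((x + n%:R) / 2).
    rewrite (_ : _ - _ = - n%:R); last by field.
    rewrite (_ : _ / 2 + _ = x); last by field.
    by apply; lra.
  cbv zeta; rewrite F0 => /(_ (fun y => iuD _ (measurable_itv _))).
  apply: filterS; first exact: (ae_filter_ringOfSetsType mu).
  move=> t Ft nt.
  by have [|_] := Ft; rewrite ?bnd_simp ?ltW// derive1_cst.
have : {ae mu, forall t (n : nat), - n%:R < t -> u t = 0} by apply/ae_foralln.
apply: filterS; first exact: (ae_filter_ringOfSetsType mu).
move=> t Ht; apply: (Ht (Num.bound `|t|)).
rewrite ltrNl; apply: le_lt_trans (archi_boundP (normr_ge0 t)).
by rewrite -normrN ler_norm.
Qed.

End fourier.

(** * Tonelli for the null sets of R^n *)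

Section lebn.
Context {R : realType}.
Notation mR := (measurableTypeR R).

Definition consp n (p : mR * n.-tuple mR) : n.+1.-tuple mR :=
  [tuple of p.1 :: p.2].

Lemma measurable_consp n : measurable_fun setT (@consp n).
Proof. by apply: (@measurable_cons _ _ _ _ fst n snd). Qed.

Definition unconsp n (z : n.+1.-tuple mR) : mR * n.-tuple mR :=
  (thead z, [tuple of behead z]).

Lemma measurable_unconsp n : measurable_fun setT (@unconsp n).
Proof.
apply/measurable_fun_pairP; split => /=.
- exact: measurable_tnth.
- exact: measurable_behead.
Qed.

Lemma conspK n : cancel (@consp n) (@unconsp n).
Proof.
move=> [t z]; rewrite /unconsp /consp/= theadE; congr pair; exact: val_inj.
Qed.

Section pushforward.
Variables (n : nat) (mu : {sigma_finite_measure set (n.-tuple mR) -> \bar R}).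

(** The successor case of [lebn] unfolds to this pushforward, which is named so that measure
    structures can be attached to it. *)
Definition pushcons : set (n.+1.-tuple mR) -> \bar R :=
  pushforward (@lebesgue_measure R \x mu)%E (@consp n).

Let pm : {measure set (n.+1.-tuple mR) -> \bar R} :=
  measure_function_pushforward__canonical__measure_function_Measure
    (@lebesgue_measure R \x mu)%E (measurable_consp n).

HB.instance Definition _ := isMeasure.Build _ _ _ pushcons
  (measure0 pm) (measure_ge0 pm) (@measure_semi_sigma_additive _ _ _ pm).

(** Both exhaustions are nondecreasing, so a pair in [F i] and [G j] lies in the product with the
    common index max(i, j). *)
Let sfpush : sigma_finite setT pushcons.
Proof.
have /sigma_finiteP[F [FT ndF Foo]] := sigma_finiteT (@lebesgue_measure R).
have /sigma_finiteP[G [GT ndG Goo]] := sigma_finiteT mu.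
exists (fun k => @unconsp n @^-1` (F k `*` G k)).
  apply/seteqP; split => // z _.
  have [i _ Fi] : (\bigcup_i F i) (thead z) by rewrite -FT.
  have [j _ Gj] : (\bigcup_j G j) [tuple of behead z] by rewrite -GT.
  exists (maxn i j) => //; split.
    by apply: subsetPset Fi; apply/ndF/leq_maxl.
  by apply: subsetPset Gj; apply/ndG/leq_maxr.
move=> k; have [mF Fy] := Foo k; have [mG Gy] := Goo k; split.
  rewrite -[X in measurable X]setTI; apply: measurable_unconsp => //.
  exact: measurableX.
rewrite /pushcons /pushforward -comp_preimage.
rewrite (_ : _ \o _ = id); last by apply/funext => p /=; exact: conspK.
by rewrite preimage_id product_measure1E// lte_mul_pinfty// ge0_fin_numE.
Qed.

HB.instance Definition _ := Measure_isSigmaFinite.Build _ _ _ pushcons sfpush.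

End pushforward.

(** [lebn] is a bare set function; this provides the structure that product measures and Tonelli
    require. *)
Lemma lebn_sigma_finite_measure n :
  exists mu : {sigma_finite_measure set (n.-tuple mR) -> \bar R},
    @lebn R n = mu :> (set (n.-tuple mR) -> \bar R).
Proof.
elim: n => [|n [mu lE]].
  by exists (\d_([tuple] : 0.-tuple mR)).
by exists (pushcons n mu); rewrite /= lE.
Qed.

Lemma lebn_negligible_section n (A : set (n.+1.-tuple mR)) :
  (@lebn R n.+1).-negligible A ->
  (@lebn R n).-negligible
    [set z : n.-tuple mR | ~ {ae @lebesgue_measure R, forall t, ~ A [tuple of t :: z]}].
Proof.
have [mu lE] := lebn_sigma_finite_measure n.
rewrite [@lebn R n.+1]/= lE => -[B [mB B0 AB]].
set B' := [set p | _] in B0.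
have mB' : measurable B'.
  by rewrite -[X in measurable X]setTI; exact: (measurable_consp n).
(* The product defining [lebn] integrates the measures of the sections at fixed t. Uniqueness of the
   product measure allows integrating those at fixed z instead. *)
have : (\int[mu]_z `|@lebesgue_measure R (ysection B' z)|)%E = 0%E.
  rewrite -[RHS]B0 (@product_measure_unique _ _ _ _ _ _ _ (@lebesgue_measure R \x^ mu)%E)//.
    by apply: eq_integral => z _; rewrite gee0_abs.
  by move=> C D mC mD /=; exact: product_measure2E.
move/ae_eq_integral_abs => /(_ measurableT (measurable_fun_ysection _ mB')).
apply: negligibleS => z /= nz h; apply: nz.
exists (ysection B' z); split => //; first exact: measurable_ysection.
  exact: h.
move=> t /= /contrapT At; rewrite /ysection/= inE; exact: AB.
Qed.

End lebn.

(** * Complex-valued functions *)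

Section complex_facts.
Context {R : realType}.
Local Notation normc := ComplexField.Normc.normc.
Local Notation Re := (@complex.Re _).
Local Notation Im := (@complex.Im _).
Implicit Types z w : R[i].

Lemma Re_mul z w : Re (z * w) = Re z * Re w - Im z * Im w.
Proof. by case: z => a b; case: w. Qed.

Lemma Im_mul z w : Im (z * w) = Re z * Im w + Im z * Re w.
Proof. by case: z => a b; case: w. Qed.

Lemma Re_add z w : Re (z + w) = Re z + Re w.
Proof. by case: z => a b; case: w. Qed.

Lemma Im_add z w : Im (z + w) = Im z + Im w.
Proof. by case: z => a b; case: w. Qed.

Lemma Re_opp z : Re (- z) = - Re z. Proof. by case: z. Qed.

Lemma Im_opp z : Im (- z) = - Im z. Proof. by case: z. Qed.

Lemma complex_eq z w : Re z = Re w -> Im z = Im w -> z = w.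
Proof. by case: z => a b; case: w => c e /= -> ->. Qed.

Lemma complex_eq0 z : Re z = 0 -> Im z = 0 -> z = 0.
Proof. by move=> z0 z1; apply: complex_eq. Qed.

Lemma normcE z : normc z = Num.sqrt (Re z ^+ 2 + Im z ^+ 2).
Proof. by case: z. Qed.

Lemma normc_ge0 z : 0 <= normc z.
Proof. by rewrite normcE sqrtr_ge0. Qed.

Lemma Re_le_normc z : `|Re z| <= normc z.
Proof. by rewrite normcE -sqrtr_sqr ler_wsqrtr// lerDl sqr_ge0. Qed.

Lemma Im_le_normc z : `|Im z| <= normc z.
Proof. by rewrite normcE -sqrtr_sqr ler_wsqrtr// lerDr sqr_ge0. Qed.

Lemma normc_cis (a : R) : normc (cis a) = 1.
Proof. by rewrite normcE/= cos2Dsin2 sqrtr1. Qed.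

Lemma cisD (a b : R) : cis (a + b) = cis a * cis b.
Proof.
apply: complex_eq; rewrite ?Re_mul ?Im_mul/=; first by rewrite cosD.
by rewrite sinD; ring.
Qed.

Lemma cis0 : cis (0 : R) = 1.
Proof. by apply: complex_eq; rewrite /= ?cos0 ?sin0. Qed.

Definition cmeasurable {d} {X : measurableType d} (D : set X) (f : X -> R[i]) :=
  measurable_fun D (fun x => Re (f x) : R) /\
  measurable_fun D (fun x => Im (f x) : R).

Definition cintegrable (D : set R) (f : R -> R[i]) :=
  (@lebesgue_measure R).-integrable D (EFin \o (fun x => Re (f x))) /\
  (@lebesgue_measure R).-integrable D (EFin \o (fun x => Im (f x))).

Section cmeasurable.
Context d {X : measurableType d}.
Implicit Types f g : X -> R[i].

Lemma cmeasurable_mul D f g : cmeasurable D f -> cmeasurable D g ->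
  cmeasurable D (fun x => f x * g x).
Proof.
move=> [f1 f2] [g1 g2]; split.
- under eq_fun do rewrite Re_mul.
  exact: (measurable_funB (measurable_funM f1 g1) (measurable_funM f2 g2)).
- under eq_fun do rewrite Im_mul.
  exact: (measurable_funD (measurable_funM f1 g2) (measurable_funM f2 g1)).
Qed.

Lemma cmeasurable_add D f g : cmeasurable D f -> cmeasurable D g ->
  cmeasurable D (fun x => f x + g x).
Proof.
move=> [f1 f2] [g1 g2]; split.
- by under eq_fun do rewrite Re_add; exact: (measurable_funD f1 g1).
- by under eq_fun do rewrite Im_add; exact: (measurable_funD f2 g2).
Qed.

Lemma measurable_normc D f : cmeasurable D f ->
  measurable_fun D (fun x => normc (f x)).
Proof.
move=> [f1 f2]; under eq_fun do rewrite normcE.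
apply: (@measurableT_comp _ _ _ _ _ _ (@Num.sqrt R)).
  exact: (continuous_measurable_fun (@sqrt_continuous R)).
exact: (measurable_funD (measurable_funX 2 f1) (measurable_funX 2 f2)).
Qed.

(** Re and Im are additive and bounded by the modulus, so convergence in modulus passes to both
    parts. *)
Lemma cmeasurable_lim (f_ : nat -> X -> R[i]) f :
  (forall k, cmeasurable setT (f_ k)) ->
  (forall x, (fun k => normc (f x - f_ k x)) @ \oo --> (0 : R)) ->
  cmeasurable setT f.
Proof.
move=> mf ff.
have lim (p : R[i] -> R) : (forall z w, p (z - w) = p z - p w) ->
    (forall z, `|p z| <= normc z) -> forall x, (fun k => p (f_ k x)) @ \oo --> p (f x).
  move=> pB pn x.
  apply: (@squeeze_cvgr _ _ _ _ (fun k => p (f x) - normc (f x - f_ k x))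
                                (fun k => p (f x) + normc (f x - f_ k x))).
  - by apply: nearW => k; have := pn (f x - f_ k x); rewrite pB ler_norml; lra.
  - by rewrite -[X in _ --> X]subr0; apply: cvgB (ff x); exact: cvg_cst.
  - by rewrite -[X in _ --> X]addr0; apply: cvgD (ff x); exact: cvg_cst.
split.
- apply: (@measurable_fun_cvg _ _ _ _ (fun k x => Re (f_ k x))) => [k|x _].
    exact: (mf k).1.
  have ReB z w : Re (z - w) = Re z - Re w by rewrite Re_add Re_opp.
  exact: (lim Re ReB Re_le_normc x).
- apply: (@measurable_fun_cvg _ _ _ _ (fun k x => Im (f_ k x))) => [k|x _].
    exact: (mf k).2.
  have ImB z w : Im (z - w) = Im z - Im w by rewrite Im_add Im_opp.
  exact: (lim Im ImB Im_le_normc x).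
Qed.

End cmeasurable.

Lemma cmeasurable_comp d d' (X : measurableType d) (Y : measurableType d')
    (f : Y -> R[i]) (h : X -> Y) :
  measurable_fun setT h -> cmeasurable setT f -> cmeasurable setT (f \o h).
Proof.
move=> mh [f1 f2]; split; first exact: (measurableT_comp f1 mh).
exact: (measurableT_comp f2 mh).
Qed.

Lemma cmeasurable_cis : cmeasurable setT (@cis R).
Proof.
split; first exact: (continuous_measurable_fun (@continuous_cos R)).
exact: (continuous_measurable_fun (@continuous_sin R)).
Qed.

Notation mu := (@lebesgue_measure R).

Lemma cintegral_mull (c : R[i]) (D : set R) (f : R -> R[i]) :
  measurable D -> cintegrable D f ->
  cintegral D (fun t => c * f t) = c * cintegral D f.
Proof.
move=> mD [f1 f2].
have iZ k h : mu.-integrable D (EFin \o h) ->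
    mu.-integrable D (EFin \o (fun t : R => k * h t)).
  by move=> ih; exact: (@integrableZl _ _ _ mu _ mD k _ ih).
apply: complex_eq; rewrite ?Re_mul ?Im_mul/=.
- under eq_Rintegral do rewrite Re_mul.
  by rewrite RintegralB//; [rewrite !RintegralZl|exact: iZ..].
- under eq_Rintegral do rewrite Im_mul.
  by rewrite RintegralD//; [rewrite !RintegralZl|exact: iZ..].
Qed.

Lemma eq_cintegral (D : set R) (f g : R -> R[i]) :
  {in D, f =1 g} -> cintegral D f = cintegral D g.
Proof. by move=> fg; congr (_ +i* _)%C; apply: eq_Rintegral => x /fg ->. Qed.

Lemma cintegral_mkcond D (f g : R -> R[i]) :
  (forall x, D x -> g x = f x) -> (forall x, ~ D x -> g x = 0) ->
  cintegral D f = cintegral setT g.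
Proof.
move=> gf g0; rewrite /cintegral [X in (X +i* _)%C]Rintegral_mkcond.
rewrite [X in (_ +i* X)%C]Rintegral_mkcond.
congr (_ +i* _)%C; apply: eq_Rintegral => x _; rewrite patchE; case: ifPn => xD.
- by rewrite gf//; exact: set_mem.
- by rewrite g0//; move=> Dx; move: xD; rewrite mem_set.
- by rewrite gf//; exact: set_mem.
- by rewrite g0//; move=> Dx; move: xD; rewrite mem_set.
Qed.

Lemma integrable_mull (f u : R -> R) : continuous f -> (forall t, `|f t| <= 1) ->
  mu.-integrable setT (EFin \o u) -> mu.-integrable setT (EFin \o (fun t => f t * u t)).
Proof.
move=> cf bf iu.
rewrite (_ : EFin \o _ = ((EFin \o f) \* (EFin \o u))%E); last first.
  by apply/funext => t /=; rewrite EFinM.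
apply: integrableMr => //; first exact: continuous_measurable_fun.
by exists 1; split; [exact: num_real|move=> x Cx t _; exact: le_trans (bf t) (ltW Cx)].
Qed.

Lemma cintegrable_cisM (h : R -> R[i]) (a b : R) : cintegrable setT h ->
  cintegrable setT (fun t => cis (a * t + b) * h t).
Proof.
have ib := integrable_mull.
have ca : continuous (fun t : R => a * t + b).
  by move=> t; apply: cvgD; [apply: cvgZr; exact: cvg_id|exact: cvg_cst].
have cc : continuous (fun t : R => cos (a * t + b)).
  by move=> t; apply: continuous_comp; [exact: ca|exact: continuous_cos].
have cs : continuous (fun t : R => sin (a * t + b)).
  by move=> t; apply: continuous_comp; [exact: ca|exact: continuous_sin].
move=> [h1 h2]; split.
- rewrite (_ : EFin \o _ = (EFin \o (fun t => (cos (a * t + b) * Re (h t))%R)) \-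
     (EFin \o (fun t => (sin (a * t + b) * Im (h t))%R)))%E; last first.
    by apply/funext => t /=; rewrite Re_mul/= EFinB.
  by apply: integrableB => //; apply: ib => // t; [exact: cos_max|exact: sin_max].
- rewrite (_ : EFin \o _ = (EFin \o (fun t => (cos (a * t + b) * Im (h t))%R)) \+
     (EFin \o (fun t => (sin (a * t + b) * Re (h t))%R)))%E; last first.
    by apply/funext => t /=; rewrite Im_mul/= EFinD.
  by apply: integrableD => //; apply: ib => // t; [exact: cos_max|exact: sin_max].
Qed.

(** Each coefficient yields two real equations that mix the parts [u] and [v]. Cosine integrals are
    even in [a] and sine integrals odd, so adding and subtracting the equations at [a] and [-a]
    separates them. *)
Theorem fourier_unique (h : R -> R[i]) : cintegrable setT h ->
  (forall a, cintegral setT (fun t => cis (- (a * t)) * h t) = 0) ->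
  {ae mu, forall t, h t = 0}.
Proof.
move=> [iu iv] h0; set u := fun t => Re (h t); set v := fun t => Im (h t).
have mul := integrable_mull.
have ca a : continuous (fun t : R => a * t).
  by move=> t; apply: cvgZr; exact: cvg_id.
have icos a (w : R -> R) : mu.-integrable setT (EFin \o w) ->
    mu.-integrable setT (EFin \o (fun t => cos (a * t) * w t)).
  apply: mul; last by move=> t; exact: cos_max.
  by move=> t; apply: continuous_comp; [exact: ca|exact: continuous_cos].
have isin a (w : R -> R) : mu.-integrable setT (EFin \o w) ->
    mu.-integrable setT (EFin \o (fun t => sin (a * t) * w t)).
  apply: mul; last by move=> t; exact: sin_max.
  by move=> t; apply: continuous_comp; [exact: ca|exact: continuous_sin].
have E1 a : (\int[mu]_(t in setT) (cos (a * t) * u t) +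
    \int[mu]_(t in setT) (sin (a * t) * v t) = 0)%R.
  rewrite -RintegralD//; [|exact: icos|exact: isin].
  have /(congr1 Re)/= <- := h0 a; apply: eq_Rintegral => t _.
  by rewrite Re_mul/= cosN sinN mulNr opprK.
have E2 a : (\int[mu]_(t in setT) (cos (a * t) * v t) -
    \int[mu]_(t in setT) (sin (a * t) * u t) = 0)%R.
  rewrite -RintegralB//; [|exact: icos|exact: isin].
  have /(congr1 Im)/= <- := h0 a; apply: eq_Rintegral => t _.
  by rewrite Im_mul/= cosN sinN mulNr.
have cN a (w : R -> R) : (\int[mu]_(t in setT) (cos (- a * t) * w t) =
    \int[mu]_(t in setT) (cos (a * t) * w t))%R.
  by apply: eq_Rintegral => t _; rewrite mulNr cosN.
have sN a (w : R -> R) : mu.-integrable setT (EFin \o w) ->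
    (\int[mu]_(t in setT) (sin (- a * t) * w t) = - \int[mu]_(t in setT) (sin (a * t) * w t))%R.
  move=> iw; rewrite -[RHS]mulN1r -RintegralZl//; last exact: isin.
  by apply: eq_Rintegral => t _; rewrite mulNr sinN mulN1r mulNr.
have u0 : {ae mu, forall t, u t = 0}.
  apply: fourier_unique_real => // a.
    by have := E1 a; have := E1 (- a); rewrite cN sN//; lra.
  by have := E2 a; have := E2 (- a); rewrite cN sN//; lra.
have v0 : {ae mu, forall t, v t = 0}.
  apply: fourier_unique_real => // a.
    by have := E2 a; have := E2 (- a); rewrite cN sN//; lra.
  by have := E1 a; have := E1 (- a); rewrite cN sN//; lra.
have F := ae_filter_ringOfSetsType mu.
by apply: filterS2 u0 v0 => t; exact: complex_eq0.
Qed.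

End complex_facts.

(** * Translations, Fubini and integrals depending on a parameter *)

Section shift.
Context {R : realType}.
Local Notation normc := ComplexField.Normc.normc.
Local Notation Re := (@complex.Re _).
Local Notation Im := (@complex.Im _).
Notation mu := (@lebesgue_measure R).

Let measurable_shift (s : R) :
  measurable_fun setT (fun t : measurableTypeR R => t + s : measurableTypeR R).
Proof.
apply: continuous_measurable_fun => t.
by apply: cvgD; [exact: cvg_id|exact: cvg_cst].
Qed.

Lemma lebesgue_measure_shift (s : R) (A : set R) : measurable A ->
  pushforward mu (fun t : measurableTypeR R => t + s : measurableTypeR R) A = mu A.
Proof.
pose nu : {measure set (measurableTypeR R) -> \bar R} :=
  measure_function_pushforward__canonical__measure_function_Measure
    mu (measurable_shift s).
move=> mA; apply/esym; apply: (@lebesgue_measure_unique _ nu) => //= _ [[a b]] _ <-.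
rewrite /pushforward (_ : _ @^-1` _ = `]a - s, b - s]%classic).
  rewrite !lebesgue_measure_itv/= !lte_fin ltrD2r -!EFinD.
  by congr (if _ then _%:E else _); ring.
by apply/seteqP; split => t /=; rewrite !in_itv/= ltrBlDr lerBrDr.
Qed.

Lemma ge0_integral_shift (s : R) (f : R -> \bar R) : measurable_fun setT f ->
  (forall t, 0 <= f t)%E -> (\int[mu]_t f (t + s)%R = \int[mu]_t f t)%E.
Proof.
move=> mf f0.
have := @ge0_integral_pushforward _ _ _ _ _ _ (measurable_shift s) mu setT f
  measurableT mf (fun t _ => f0 t).
rewrite preimage_setT => <-.
by apply: eq_measure_integral => //= A mA _; exact: lebesgue_measure_shift.
Qed.

Lemma integrable_shift (s : R) (f : R -> R) : mu.-integrable setT (EFin \o f) ->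
  mu.-integrable setT (EFin \o (fun t => f (t + s))).
Proof.
move=> /integrableP[mf fy]; apply/integrableP; split.
  exact: (measurableT_comp mf (measurable_shift s)).
have := ge0_integral_shift s (fun t => `|(f t)%:E|)%E.
have mf' : measurable_fun (setT : set R) (EFin \o f) := mf.
move=> /= ->//; apply: (@measurableT_comp _ _ _ _ _ _ abse _ (EFin \o f)) => //.
Qed.

Lemma Rintegral_shift (s : R) (f : R -> R) : mu.-integrable setT (EFin \o f) ->
  (\int[mu]_(t in setT) f (t + s) = \int[mu]_(t in setT) f t)%R.
Proof.
move=> fi; rewrite /Rintegral; congr fine.
have := @integral_pushforward _ _ _ _ _ _ (measurable_shift s) mu setT (EFin \o f)
  (measurable_int _ fi).
rewrite preimage_setT => /(_ (integrable_shift s f fi) measurableT) <-.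
by apply: eq_measure_integral => //= A mA _; exact: lebesgue_measure_shift.
Qed.

Lemma cintegrable_shift (s : R) (f : R -> R[i]) : cintegrable setT f ->
  cintegrable setT (fun t => f (t + s)).
Proof. by move=> [f1 f2]; split; [move: f1|move: f2] => /(integrable_shift s). Qed.

Lemma cintegral_shift (s : R) (f : R -> R[i]) : cintegrable setT f ->
  cintegral setT (fun t => f (t + s)) = cintegral setT f.
Proof.
move=> [f1 f2]; congr (_ +i* _)%C.
  exact: (Rintegral_shift s (fun t => Re (f t)) f1).
exact: (Rintegral_shift s (fun t => Im (f t)) f2).
Qed.

Lemma Rintegral_fubini0 (K : R * R -> R) :
  (mu \x mu)%E.-integrable setT (EFin \o K) ->
  {ae mu, forall t, (\int[mu]_(s in setT) K (t, s) = 0)%R} ->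
  (\int[mu]_(s in setT) (\int[mu]_(t in setT) K (t, s)) = 0)%R.
Proof.
move=> iK K0; rewrite {1}/Rintegral.
have FF := ae_filter_ringOfSetsType mu.
(* Sections of [K] are integrable only for almost every [s], so the real and extended inner
   integrals are identified only almost everywhere. *)
have -> : (\int[mu]_s (\int[mu]_(t in setT) K (t, s))%R%:E =
    \int[mu]_s \int[mu]_t (K (t, s))%:E)%E.
  apply: ae_eq_integral => //.
  - apply/measurable_EFinP; apply: (measurableT_comp (fine_measurable measurableT)).
    exact: (measurable_fubini_G iK).
  - exact: (measurable_fubini_G iK).
  - apply: filterS (ae_integrable2 iK) => s iKs _.
    by rewrite /Rintegral fineK//; exact: integrable_fin_num.
have <- := Fubini iK.
rewrite (_ : (\int[mu]_t _)%E = 0%E)//.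
rewrite -(@integral0 _ _ _ mu setT).
apply: ae_eq_integral => //; first exact: (measurable_fubini_F iK).
apply: filterS2 (ae_integrable1 iK) K0 => t iKt {}K0 _ /=.
rewrite -[LHS]fineK; last exact: integrable_fin_num.
by congr EFin.
Qed.

End shift.

Section parameter.
Context {R : realType} {T : topologicalType}.
Notation mu := (@lebesgue_measure R).

(** Instead of a decreasing base, [U n] is eventually inside every neighbourhood: exactly what makes
    any choice of points [y n] in [U n] converge to [x]. *)
Definition first_countable_at (x : T) := exists U : nat -> set T,
  (forall n, nbhs x (U n)) /\
  forall V, nbhs x V -> \forall n \near \oo, U n `<=` V.

(** Dominated convergence handles sequences only. If continuity failed, first countability would
    give a sequence tending to [x] along which the integrals stay at distance [e]. *)
Lemma continuous_Rintegral (k : R -> T -> R) (G : R -> \bar R) x :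
  first_countable_at x -> (forall t, {for x, continuous (k t)}) ->
  (forall y, measurable_fun setT (k^~ y)) ->
  (forall t y, `|k t y|%:E <= G t)%E -> mu.-integrable setT G ->
  {for x, continuous (fun y => (\int[mu]_(t in setT) k t y)%R)}.
Proof.
move=> [U [nU UV]] ck mk kG iG.
have ik y : mu.-integrable setT (EFin \o k^~ y).
  apply: le_integrable iG => //; first by apply/measurable_EFinP; exact: mk.
  move=> t _ /=; apply: (le_trans (kG t y)); exact: lee_abs.
apply/cvgrPdist_lt => e e0; apply: contrapT => nn.
have /choice[y yP] : forall n, exists y, U n y /\
    e <= `|(\int[mu]_(t in setT) k t x)%R - (\int[mu]_(t in setT) k t y)%R|.
  move=> n; apply: contrapT => ny; apply: nn; near=> z.
  rewrite ltNge; apply/negP => h; apply: ny; exists z; split => //.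
  by near: z; exact: nU.
have [|||||_ _ +] := @dominated_convergence _ _ _ mu setT measurableT
  (fun n t => (k t (y n))%:E) (fun t => (k t x)%:E) G.
- by move=> n; apply/measurable_EFinP; exact: mk.
- by apply/measurable_EFinP; exact: mk.
- apply: aeW => t _; apply: cvg_EFin; first exact: nearW.
  have yx : y @ \oo --> x.
    move=> V /UV; apply: filterS => n; apply; exact: (yP n).1.
  exact: (cvg_comp _ _ yx (ck t)).
- exact: iG.
- by apply: aeW => t n _; exact: kG.
have E z : (\int[mu]_t (k t z)%:E)%E = (\int[mu]_(t in setT) k t z)%R%:E.
  by rewrite /Rintegral fineK//; exact: (integrable_fin_num measurableT (ik z)).
rewrite E.
rewrite (_ : [sequence _]_n = EFin \o (fun n => \int[mu]_(t in setT) k t (y n))%R);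
  last first.
  by apply/funext => n /=; rewrite E.
move=> /fine_cvg/= /cvgrPdist_lt /(_ _ e0)[N _ /(_ N (leqnn N))].
by rewrite ltNge (yP N).2.
Unshelve. all: by end_near. Qed.

End parameter.

(** * The partial Fourier transform of a Bochner integrable function *)

Section bochner.
Context {R : realType} {T : topologicalType}.
Local Notation normc := ComplexField.Normc.normc.
Local Notation Re := (@complex.Re _).
Local Notation Im := (@complex.Im _).
Notation mu := (@lebesgue_measure R).

Lemma continuous_normc (f : T -> R[i]) :
  ccontinuous f -> continuous (fun x => normc (f x)).
Proof.
move=> [f1 f2]; under eq_fun do rewrite normcE.
move=> x; apply: continuous_comp; last exact: sqrt_continuous.
by apply: cvgD; under eq_fun do rewrite expr2; apply: cvgM; (exact: f1 || exact: f2).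
Qed.

Lemma ccontinuous_mull (c : R[i]) (f : T -> R[i]) :
  ccontinuous f -> ccontinuous (fun x => c * f x).
Proof.
move=> [f1 f2]; split => x.
- under eq_fun do rewrite Re_mul.
  by apply: cvgB; apply: cvgZr; [exact: f1|exact: f2].
- under eq_fun do rewrite Im_mul.
  by apply: cvgD; apply: cvgZr; [exact: f2|exact: f1].
Qed.

(** [T] has no sigma-algebra; measurability of [p] is expressed by testing it against continuous
    functions. *)
Lemma cmeasurable_simple_val d (X : measurableType d) (a : X -> measurableTypeR R)
    (p : X -> T) (s : seq (set (measurableTypeR R) * (T -> R[i]))) :
  measurable_fun setT a ->
  (forall f : T -> R[i], ccontinuous f -> cmeasurable setT (f \o p)) ->
  (forall j, (j < size s)%N ->
     let q := nth (set0, fun=> 0) s j in measurable q.1 /\ ccontinuous q.2) ->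
  cmeasurable setT (fun x => simple_val s (a x) (p x)).
Proof.
move=> ma mp; elim: s => [_|q s IH sP].
  by rewrite /simple_val; under eq_fun do rewrite big_nil; split; exact: measurable_cst.
rewrite /simple_val; under eq_fun do rewrite big_cons.
apply: cmeasurable_add; last by apply: IH => j js; exact: (sP j.+1).
have [mq cq] := sP 0 isT.
apply: cmeasurable_mul; last exact: mp.
split; last exact: measurable_cst.
exact: (measurableT_comp (measurable_indic mq) ma).
Qed.

Section transform.
Variable S : R -> T -> R[i].
Hypothesis BS : Bochner_L1 S.
Variable e : nat -> T.
Hypothesis dense_e : forall U : set T, open U -> U !=set0 -> exists n, U (e n).

Lemma normc_le_supnorm t x : ((normc (S t x))%:E <= supnorm (S t))%E.
Proof. by apply: ereal_sup_ubound; exists x. Qed.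

(** Convergence in sup norm at each time gives pointwise convergence along any pair of maps [a],
    [p]. With a(t, s) = t + s and the geodesic as [p], this is the joint measurability that Fubini
    requires. *)
Lemma cmeasurable_bochner d (X : measurableType d) (a : X -> measurableTypeR R)
    (p : X -> T) :
  measurable_fun setT a ->
  (forall f : T -> R[i], ccontinuous f -> cmeasurable setT (f \o p)) ->
  cmeasurable setT (fun x => S (a x) (p x)).
Proof.
move=> ma mp; have [_ [s [sP sS]] _] := BS.
apply: (cmeasurable_lim _ (fun k x => simple_val (s k) (a x) (p x))) => [k|x].
  by apply: cmeasurable_simple_val => // j /(sP k)[].
have : (fun k => (normc (S (a x) (p x) - simple_val (s k) (a x) (p x)))%:E) @ \oo
    --> (0 : R)%:E.
  apply: (@squeeze_cvge _ _ _ _ (fun=> 0%E) _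
    (fun k => supnorm (fun y => S (a x) y - simple_val (s k) (a x) y))).
  - apply: nearW => k; rewrite lee_fin normc_ge0/=.
    by apply: ereal_sup_ubound; exists (p x).
  - exact: cvg_cst.
  - exact: sS.
exact: fine_cvg.
Qed.

(** Superlevel sets of the continuous modulus are open, hence meet the dense sequence. A countable
    supremum makes the norm measurable in [t]. *)
Lemma supnorm_dense t :
  supnorm (S t) = ereal_sup (range (fun n => (normc (S t (e n)))%:E)).
Proof.
apply/eqP; rewrite eq_le; apply/andP; split; last first.
  by apply: ub_ereal_sup => _ [n _ <-]; exact: normc_le_supnorm.
apply: ub_ereal_sup => _ [x _ <-]; rewrite leNgt; apply/negP => lt.
set s := ereal_sup _ in lt.
have se n : ((normc (S t (e n)))%:E <= s)%E by apply: ereal_sup_ubound; exists n.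
have cS : continuous (fun y => normc (S t y)).
  by apply: continuous_normc; case: BS.
have oU : open [set y | fine s < normc (S t y)].
  rewrite (_ : [set y | _] = (fun y => normc (S t y)) @^-1` [set r | r > fine s])//.
  by apply: open_comp; [move=> y _; exact: cS|exact: open_gt].
have sf : s \is a fin_num.
  rewrite fin_numE; apply/andP; split; apply/eqP => sE.
    by have := se 0%N; rewrite sE leeNy_eq.
  by move: lt; rewrite sE ltNge leey.
have [|n /=] := dense_e _ oU.
  by exists x => /=; rewrite -lte_fin fineK.
by rewrite ltNge -lee_fin fineK// se.
Qed.

Lemma cmeasurable_bochner_section x : cmeasurable setT (S^~ x).
Proof.
by apply: (cmeasurable_bochner _ _ id (fun=> x)).
Qed.

Lemma measurable_supnorm : measurable_fun setT (fun t => supnorm (S t)).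
Proof.
rewrite (_ : (fun t => _) = fun t => esups (fun n => (normc (S t (e n)))%:E) 0).
  apply: (@measurable_fun_esups _ _ _ _ (fun n t => (normc (S t (e n)))%:E)) => n.
  apply/measurable_EFinP; apply: measurable_normc.
  exact: cmeasurable_bochner_section.
apply/funext => t; rewrite supnorm_dense /esups /sdrop; congr ereal_sup.
by apply/seteqP; split => _ [n _ <-]; exists n.
Qed.

Lemma supnorm_ge0 t : (0 <= supnorm (S t))%E.
Proof. by apply: le_trans (normc_le_supnorm t (e 0)); rewrite lee_fin normc_ge0. Qed.

Lemma integrable_supnorm : mu.-integrable setT (fun t => supnorm (S t)).
Proof.
apply/integrableP; split; first exact: measurable_supnorm.
have [_ _] := BS; apply: le_lt_trans; rewrite le_eqVlt; apply/orP; left; apply/eqP.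
by apply: eq_integral => t _; rewrite gee0_abs// supnorm_ge0.
Qed.

Lemma cintegrable_bochner x : cintegrable setT (S^~ x).
Proof.
have [m1 m2] := cmeasurable_bochner_section x; split.
- apply: le_integrable integrable_supnorm => //.
    by apply/measurable_EFinP; exact: m1.
  move=> t _ /=; rewrite gee0_abs ?supnorm_ge0//.
  by apply: le_trans (normc_le_supnorm t x); rewrite lee_fin Re_le_normc.
- apply: le_integrable integrable_supnorm => //.
    by apply/measurable_EFinP; exact: m2.
  move=> t _ /=; rewrite gee0_abs ?supnorm_ge0//.
  by apply: le_trans (normc_le_supnorm t x); rewrite lee_fin Im_le_normc.
Qed.

Definition time_fourier (eta : R) (x : T) : R[i] :=
  cintegral setT (fun t => cis (- (eta * t)) * S t x).

Lemma ccontinuous_time_fourier eta : (forall x : T, first_countable_at x) ->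
  ccontinuous (time_fourier eta).
Proof.
move=> fc.
have cS t : ccontinuous (fun x => cis (- (eta * t)) * S t x).
  by apply: ccontinuous_mull; case: BS.
have mS y : cmeasurable setT (fun t => cis (- (eta * t)) * S t y).
  apply: cmeasurable_mul; last exact: cmeasurable_bochner_section.
  apply: (cmeasurable_comp _ _ _ _ _ (fun t : R => - (eta * t)));
    last exact: cmeasurable_cis.
  apply: continuous_measurable_fun => t.
  by apply: cvgN; apply: cvgZr; exact: cvg_id.
have bS t y (r : R) : `|r| <= normc (cis (- (eta * t)) * S t y) ->
    (`|r|%:E <= supnorm (S t))%E.
  rewrite ComplexField.Normc.normcM normc_cis mul1r => h.
  by apply: le_trans (normc_le_supnorm t y); rewrite lee_fin.
split => x.
- apply: (continuous_Rintegral (fun t x => Re (cis (- (eta * t)) * S t x))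
    _ x (fc x) _ _ _ integrable_supnorm).
  + by move=> t; exact: (cS t).1.
  + by move=> y; exact: (mS y).1.
  + by move=> t y; apply: (bS t y); exact: Re_le_normc.
- apply: (continuous_Rintegral (fun t x => Im (cis (- (eta * t)) * S t x))
    _ x (fc x) _ _ _ integrable_supnorm).
  + by move=> t; exact: (cS t).2.
  + by move=> y; exact: (mS y).2.
  + by move=> t y; apply: (bS t y); exact: Im_le_normc.
Qed.

(** Uniqueness at a point gives a null set of times depending on that point. Only the countably many
    sets at the [e n] are united; [supnorm_dense] then covers all x. *)
Lemma time_fourier_inj : (forall eta x, time_fourier eta x = 0) ->
  {ae mu, forall t x, S t x = 0}.
Proof.
move=> S0.
have FF := ae_filter_ringOfSetsType mu.
have : {ae mu, forall t n, S t (e n) = 0}.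
  apply/ae_foralln => n; apply: fourier_unique; first exact: cintegrable_bochner.
  by move=> eta; exact: S0.
apply: filterS => t Se x.
apply: ComplexField.Normc.eq0_normc; apply/eqP; rewrite eq_le normc_ge0 andbT.
have := normc_le_supnorm t x; rewrite supnorm_dense -lee_fin => /le_trans; apply.
apply: ub_ereal_sup => _ [n _ <-].
by rewrite Se ComplexField.Normc.normc0.
Qed.

(** Here [p] and [w] stand for the geodesic and the weight, extended to the whole line. Integrating
    [K] over s gives 0 for almost every t; integrating it over t, after translation by s, gives the
    integrand of the conclusion, the factor e^{i eta s} being left by the translation. *)
Lemma cintegral_time_fourier (p : R -> T) (w : R -> R[i]) (C tau : R) :
  (forall f : T -> R[i], ccontinuous f -> cmeasurable setT (f \o p)) ->
  cmeasurable setT w -> (forall s, normc (w s) <= C) ->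
  (forall s, ~ `[0, tau]%classic s -> w s = 0) ->
  {ae mu, forall t, cintegral setT (fun s => S (t + s) (p s) * w s) = 0} ->
  forall eta,
  cintegral setT (fun s => cis (eta * s) * w s * time_fourier eta (p s)) = 0.
Proof.
move=> mp mw wC w0 S0 eta.
have FF := ae_filter_ringOfSetsType mu.
pose K (z : R * R) := cis (- (eta * z.1)) * (S (z.1 + z.2) (p z.2) * w z.2).
have mK : cmeasurable setT K.
  apply: cmeasurable_mul.
    apply: (cmeasurable_comp _ _ _ _ _ (fun z : R * R => - (eta * z.1)));
      last exact: cmeasurable_cis.
    apply: (measurableT_comp (f := fun t : R => - (eta * t)) _ measurable_fst).
    apply: continuous_measurable_fun => t.
    by apply: cvgN; apply: cvgZr; exact: cvg_id.
  apply: cmeasurable_mul; last exact: (cmeasurable_comp _ _ _ _ w snd).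
  apply: (cmeasurable_bochner _ _ (fun z : R * R => z.1 + z.2) (fun z => p z.2)).
    exact: (measurable_funD measurable_fst measurable_snd).
  by move=> f /mp mf; exact: (cmeasurable_comp _ _ _ _ (f \o p) snd).
have C0 : 0 <= C by exact: le_trans (normc_ge0 _) (wC 0).
have KC t s : ((normc (K (t, s)))%:E <=
    (C * \1_(`[0%R, tau]%classic) s)%:E * supnorm (S (t + s)))%E.
  rewrite /K/= !ComplexField.Normc.normcM normc_cis mul1r EFinM muleC.
  apply: lee_pmul; rewrite ?lee_fin ?normc_ge0//; last exact: normc_le_supnorm.
  rewrite indicE; have [ss|ss] := boolP (s \in _); first by rewrite mulr1.
  by rewrite w0 ?ComplexField.Normc.normc0 ?mulr0//; move: ss; rewrite notin_setE.
have iK (q : R[i] -> R) : (forall z, `|q z| <= normc z) ->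
    measurable_fun setT (q \o K) -> (mu \x mu)%E.-integrable setT (EFin \o (q \o K)).
  (* The inner integral runs over t: by translation invariance its bound depends on s only through
     the indicator of [0, tau]. *)
  move=> qn mq; apply/integrable21ltyP; first exact/measurable_EFinP.
  pose I := (\int[mu]_t supnorm (S t))%E.
  have Iy : (I < +oo)%E by have [_ _] := BS.
  have I0 : (0 <= I)%E by apply: integral_ge0 => t _; exact: supnorm_ge0.
  apply: (@le_lt_trans _ _ (\int[mu]_s (C%:E * I * (\1_(`[0%R, tau]%classic) s)%:E))%E).
    apply: ge0_le_integral => //.
    - by move=> s _; exact: integral_ge0.
    - apply: (@measurable_fun_fubini_tonelli_G _ _ _ _ _ mu
        (fun z => `|(q (K z))%:E|%E)) => //.
      apply: (@measurableT_comp _ _ _ _ _ _ abse _ (EFin \o (q \o K))) => //.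
      exact/measurable_EFinP.
    - apply: emeasurable_funM => //.
      by apply/measurable_EFinP; exact: measurable_indic.
    - move=> s _.
      have <- : (\int[mu]_t ((C * \1_(`[0%R, tau]%classic) s)%:E * supnorm (S (t + s)%R)) =
        C%:E * I * (\1_(`[0%R, tau]%classic) s)%:E)%E.
        rewrite ge0_integralZl//.
        + rewrite (ge0_integral_shift s (fun t => supnorm (S t)) measurable_supnorm supnorm_ge0).
          by rewrite EFinM muleAC.
        + have mshift : measurable_fun (setT : set R) (fun t : R => t + s).
            by exact: (measurable_funD (@measurable_id _ _ _) (measurable_cst _)).
          exact: (measurableT_comp measurable_supnorm mshift).
        + by move=> t _; exact: supnorm_ge0.
        + by rewrite lee_fin mulr_ge0.
      apply: ge0_le_integral => //.
      + apply: (@measurableT_comp _ _ _ _ _ _ abse _ (fun t => (q (K (t, s)))%:E)) => //.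
        apply/measurable_EFinP.
        exact: (@measurable_fun_pair1 _ _ _ _ _ _ (q \o K) s mq).
      + apply: emeasurable_funM => //.
        have mshift : measurable_fun (setT : set R) (fun t : R => t + s).
          by exact: (measurable_funD (@measurable_id _ _ _) (measurable_cst _)).
        exact: (measurableT_comp measurable_supnorm mshift).
      + move=> t _; apply: le_trans (KC t s); rewrite lee_fin; exact: qn.
  rewrite ge0_integralZl//.
  - rewrite integral_indic// setIT.
    rewrite [X in (_ * X)%E](lebesgue_measure_itv (`[0, tau] : interval R))/= lte_fin.
    apply: lte_mul_pinfty => //; first exact: mule_ge0.
      by rewrite fin_numM// ge0_fin_numE.
    by case: ifP => _; rewrite -?EFinB ltry.
  - by apply/measurable_EFinP; exact: measurable_indic.
  - exact: mule_ge0.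
have iRe : (mu \x mu)%E.-integrable setT (EFin \o (fun z => Re (K z))).
  exact: (iK (fun z => Re z) Re_le_normc mK.1).
have iIm : (mu \x mu)%E.-integrable setT (EFin \o (fun z => Im (K z))).
  exact: (iK (fun z => Im z) Im_le_normc mK.2).
have K0 : {ae mu, forall t, cintegral setT (fun s => K (t, s)) = 0}.
  (* Fubini gives integrability of [K (t, _)] itself, for almost every t; hence the phase is pulled
     out of an integral of [K] and then cancelled. *)
  apply: filterS3 (ae_integrable1 iRe) (ae_integrable1 iIm) S0 => t i1 i2.
  have iKt : cintegrable setT (fun s => K (t, s)) by split.
  rewrite (@eq_cintegral _ _ _ (fun s => cis (eta * t) * K (t, s))); last first.
    by move=> s _; rewrite /K/= mulrA -cisD subrr cis0 mul1r.
  rewrite cintegral_mull// => /(congr1 (fun z => cis (- (eta * t)) * z)).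
  by rewrite mulrA -cisD addNr cis0 mul1r mulr0.
have E s : cis (eta * s) * w s * time_fourier eta (p s) = cintegral setT (fun t => K (t, s)).
  pose h t := cis (- (eta * t)) * S t (p s).
  have ih : cintegrable setT h.
    have := cintegrable_cisM _ (- eta) 0 (cintegrable_bochner (p s)).
    by rewrite (_ : (fun t => _) = h)//; apply/funext => t; rewrite mulNr addr0.
  rewrite /time_fourier -(cintegral_shift s _ ih) -cintegral_mull//;
    last exact: cintegrable_shift.
  apply: eq_cintegral => t _; rewrite /h /K/=.
  have -> : - (eta * t) = eta * s - eta * (t + s) by ring.
  by rewrite cisD; ring.
rewrite (eq_cintegral _ _ (fun s => cintegral setT (fun t => K (t, s)))); last first.
  by move=> s _; exact: E.
apply: complex_eq0 => /=.
- apply: (Rintegral_fubini0 (fun z => Re (K z)) iRe).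
  by apply: filterS K0 => t /(congr1 Re).
- apply: (Rintegral_fubini0 (fun z => Im (K z)) iIm).
  by apply: filterS K0 => t /(congr1 Im).
Qed.

End transform.
End bochner.

(** * Countability and measurability in charts *)

Section rational_balls.
Context {R : realType}.

Definition ratr_row n (q : 'rV[rat]_n) : 'rV[R]_n := map_mx ratr q.

Lemma rational_ball_dense n (x : 'rV[R]_n) (r : R) : 0 < r ->
  exists q : 'rV[rat]_n, ball (ratr_row n q) r x.
Proof.
move=> r0.
have /choice[q qP] : forall j : 'I_n, exists a : rat, ball (ratr a : R) r (x 0 j).
  move=> j; have [|a] := @rat_in_itvoo R (x 0 j - r) (x 0 j + r); first lra.
  rewrite in_itv/= => /andP[a1 a2]; exists a.
  by rewrite /ball/= ltr_norml; lra.
exists (\row_j q j); split => // i j; rewrite ord1 !mxE; exact: qP.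
Qed.

Lemma small_invn (r : R) : 0 < r -> exists k : nat, k.+1%:R^-1 < r.
Proof.
move=> r0; have := @near_infty_natSinv_lt R (PosNum r0).
by move=> [k _ /(_ k (leqnn k))] kr; exists k.
Qed.

(* Open sets of row vectors are countable unions of rational balls, so that
   entrywise measurability is enough. *)
Lemma measurable_preimage_open d (X : measurableType d) n (E : set X)
    (F : X -> 'rV[R]_n) (O : set 'rV[R]_n) :
  measurable E -> (forall j, measurable_fun E (fun x => F x 0 j)) -> open O ->
  measurable (E `&` F @^-1` O).
Proof.
move=> mE mF oO.
pose B (qk : 'rV[rat]_n * nat) := ball (ratr_row n qk.1) qk.2.+1%:R^-1.
have -> : E `&` F @^-1` O =
    \bigcup_qk (if `[< B qk `<=` O >] then E `&` F @^-1` B qk else set0).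
  apply/seteqP; split => [x [Ex Ox]|x [qk _]]; last first.
    by case: ifPn => // /asboolP BO [Ex Bx]; split => //; exact: BO.
  have [e /= e0 eO] := (nbhs_ballP _ _).1 (open_nbhs_nbhs (conj oO Ox)).
  have [k kr] := small_invn (e / 2) (divr_gt0 e0 (ltr0Sn R 1)).
  have k0 : (0 : R) < k.+1%:R^-1 by rewrite invr_gt0.
  have [q qx] := rational_ball_dense _ (F x) _ k0.
  exists (q, k) => //; rewrite ifT//; apply/asboolP => y qy; apply: eO.
  apply: (@ball_splitr _ _ (ratr_row _ q)); apply: le_ball (ltW kr) _ _ => //.
apply: countable_bigcupT_measurable; first exact: countableP.
move=> qk; case: ifPn => // _.
have -> : E `&` F @^-1` B qk = E `&` \bigcap_(j in [set: 'I_n])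
    (E `&` (fun x => F x 0 j) @^-1` (ball ((ratr_row n qk.1) 0 j) qk.2.+1%:R^-1)).
  apply/seteqP; split => x [Ex Bx]; split => //.
    by move=> j _; split => //; exact: Bx.2.
  by split => [|i j]; rewrite ?ord1 ?invr_gt0//; exact: (Bx j I).2.
apply: measurableI => //; apply: fin_bigcap_measurable => // j _.
by apply: mF => //; exact: measurable_ball.
Qed.

(** The preimage of an interval under [h] is the trace on [A] of an open set; as [F] maps [E] into
    [A], pulling back that open set is enough. *)
Lemma measurable_within_continuous_comp d (X : measurableType d) n (E : set X)
    (F : X -> 'rV[R]_n) (A : set 'rV[R]_n) (h : 'rV[R]_n -> R) :
  measurable E -> (forall j, measurable_fun E (fun x => F x 0 j)) ->
  (forall x, E x -> A (F x)) -> {within A, continuous h} ->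
  measurable_fun E (h \o F).
Proof.
move=> mE mF EA /continuousP ch; apply: (measurability _ (RGenOpens.measurableE R)).
move=> _ [_ [a [b ->] <-]].
have /open_subspaceP[V oV VA] := ch `]a, b[%classic
  (@interval_open R (BRight a) (BLeft b) isT isT).
rewrite (_ : _ `&` _ = E `&` F @^-1` V); first exact: measurable_preimage_open.
apply/seteqP; split => x [Ex]; [move=> hx|move=> Vx]; split => //.
  have : (h @^-1` `]a, b[ `&` A) (F x) by split => //; exact: EA.
  by rewrite -VA => -[].
have : (V `&` A) (F x) by split => //; exact: EA.
by rewrite VA => -[].
Qed.

End rational_balls.

(** * First countability, countable chart covers and dense sequences *)

Section charts.
Import finmap.
Context {R : realType} {m : nat} {M : cmanifold R m}.

(** Continuity of the inverse chart within the chart image, read at [coord i x]. *)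
Lemma chart_nbhs (i : idx M) (x : M) (V : set M) : dom i x -> nbhs x V ->
  exists2 r : R, 0 < r &
    forall y, dom i y -> ball (coord i x) r (coord i y) -> V y.
Proof.
move=> ix Vx.
have iim : (coord i @` dom i) (coord i x) by exists x.
have := (subspace_continuousP _ _).1 (@coord_inv_continuous _ _ M i) _ iim.
rewrite /from_subspace (coordK ix) => /(_ _ Vx) h.
have {}h : nbhs (coord i x) [set y | (coord i @` dom i) y -> V (coord_inv i y)].
  exact: h.
have [r /= r0 rV] := (nbhs_ballP _ _).1 h.
exists r => // y iy /rV /=; rewrite (coordK iy); apply.
by exists y.
Qed.

Lemma cmanifold_first_countable (x : M) : first_countable_at x.
Proof.
have [i ix] := @dom_cover _ _ M x.
exists (fun n => dom i `&` coord i @^-1` ball (coord i x) n.+1%:R^-1); split.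
  move=> n; apply: filterI; first exact: open_nbhs_nbhs (conj (dom_open i) ix).
  apply: (coord_continuous ix); apply: nbhsx_ballx.
  by rewrite invr_gt0.
move=> V /(chart_nbhs i x V ix)[r r0 rV].
near=> n => y [iy xy]; apply: rV => //.
apply: le_ball xy; apply/ltW; near: n.
exact: (@near_infty_natSinv_lt R (PosNum r0)).
Unshelve. all: by end_near. Qed.

Lemma countable_chart_cover (x0 : M) :
  exists c : nat -> idx M, forall x, exists n, dom (c n) x.
Proof.
have [i0 _] := @dom_cover _ _ M x0.
pose T : ptopologicalType := HB.pack (mpt M) (isPointed.Build (mpt M) x0).
have : @compact T setT by exact: (@m_compact _ _ M).
(* [idx M] is a bare type, so the cover is indexed by the chart domains themselves; an index is
   chosen for each afterwards, with [i0] as padding. *)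
rewrite compact_cover => /(_ (set T) (range (@dom _ _ M)) id)[].
- by move=> _ [i _ <-]; exact: dom_open.
- move=> x _; have [i ix] := @dom_cover _ _ M x.
  by exists (dom i) => //; exists i.
move=> D' D'D covD'.
have /choice[c cP] : forall n, exists i : idx M,
    (n < size (enum_fset D'))%N -> nth set0 (enum_fset D') n = dom i.
  move=> n; have [nD|nD] := ltnP n (size (enum_fset D')); last by exists i0.
  have /D'D/set_mem[i _ <-] : nth set0 (enum_fset D') n \in D' by exact: mem_nth.
  by exists i.
exists c => x; have [//|U UD' Ux] := covD' x.
have UD : U \in enum_fset D' by exact: UD'.
exists (index U (enum_fset D')).
by rewrite -cP ?index_mem// nth_index.
Qed.

(** Rational points may fall outside a chart image, so one point is chosen in each nonempty trace of
    a rational ball. *)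
Lemma cmanifold_dense_sequence (x0 : M) :
  exists e : nat -> M, forall U : set M, open U -> U !=set0 -> exists n, U (e n).
Proof.
have [c cP] := countable_chart_cover x0.
pose I := (nat * 'rV[rat]_m.+1 * nat)%type.
pose P (p : I) y := dom (c p.1.1) y /\
  ball (ratr_row m.+1 p.1.2) p.2.+1%:R^-1 (coord (c p.1.1) y).
have /choice[e eP] : forall p : I, exists y, (exists y', P p y') -> P p y.
  move=> p; have [[y Py]|nP] := pselect (exists y', P p y'); first by exists y.
  by exists x0 => /nP.
exists (fun n => if @choice.unpickle I n is Some p then e p else x0) => U oU [x Ux].
have [n nx] := cP x.
have [r r0 rU] := chart_nbhs _ _ _ nx (open_nbhs_nbhs (conj oU Ux)).
have [k kr] := small_invn (r / 2) (divr_gt0 r0 (ltr0Sn R 1)).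
have k0 : (0 : R) < k.+1%:R^-1 by rewrite invr_gt0.
have [q qx] := rational_ball_dense _ (coord (c n) x) _ k0.
pose p : I := (n, q, k).
exists (@choice.pickle I p); rewrite choice.pickleK.
have [ny qy] : P p (e p) by apply: eP; exists x.
apply: rU => //.
by apply: (@ball_splitr _ _ (ratr_row _ q)); apply: le_ball (ltW kr) _ _.
Qed.

End charts.

(** * Geodesics *)

Section geodesics.
Context {R : realType} {m : nat} {M : cmanifold R m} (g : riemannian M).
Local Notation normc := ComplexField.Normc.normc.
Local Notation Re := (@complex.Re _).
Local Notation Im := (@complex.Im _).
Notation mu := (@lebesgue_measure R).
Notation mR := (measurableTypeR R).

(** u(s + h) is u(s) plus h times the difference quotient, and the latter converges. *)
Lemma deriv_on_continuous n (D : set R) (u : R -> 'rV[R]_n.+1) (s : R) l :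
  deriv_on D u s l -> u r @[r --> within D (nbhs s)] --> u s.
Proof.
move=> du V Vus.
pose G := within [set h | D (s + h)] (0 : R)^'.
have FG : Filter G by exact: within_filter.
have h0 : h @[h --> G] --> (0 : R).
  by apply: cvg_within_filter; apply: cvg_within_filter; exact: cvg_id.
have : u s + h *: (h^-1 *: (u (s + h) - u s)) @[h --> G] --> u s + 0 *: l.
  by apply: cvgD; [exact: cvg_cst|exact: cvgZ h0 du].
rewrite scale0r addr0 => /(_ _ Vus) GV.
(* The punctured filter omits h = 0, which is restored separately. *)
have {}GV : nbhs (0 : R) [set h | D (s + h) -> V (u (s + h))].
  have : nbhs (0 : R) [set h | h != 0 -> D (s + h) ->
     V (u s + h *: (h^-1 *: (u (s + h) - u s)))] := GV.
  apply: filterS => h GVh Dh; have [hE|hN] := eqVneq h 0.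
    by rewrite hE addr0; exact: nbhs_singleton.
  by have := GVh hN Dh; rewrite scalerA mulfV// scale1r addrC subrK.
suff : nbhs s [set r | D r -> V (u r)] by [].
have sh : (r - s) @[r --> s] --> (0 : R).
  by rewrite -(subrr s); apply: cvgB; [exact: cvg_id|exact: cvg_cst].
have {}GV : nbhs s [set r | D (s + (r - s)) -> V (u (s + (r - s)))] := sh _ GV.
by apply: filterS GV => r /=; rewrite addrC subrK.
Qed.

Lemma smooth_on_continuous n (A : set 'rV[R]_n) (f : 'rV[R]_n -> R) :
  smooth_on A f -> {within A, continuous f}.
Proof.
move=> sf; apply/subspace_continuousP => y Ay.
have [U [F [oU Uy CF fF]]] := sf y Ay.
have cF := (CF 0%N).1.
rewrite /from_subspace (fF y Uy Ay).
apply: (@cvg_trans _ (F z @[z --> within A (nbhs y)])); last first.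
  by apply: cvg_within_filter; exact: cF.
apply: near_eq_cvg; apply: filterS (open_nbhs_nbhs (conj oU Uy)) => z Uz Az.
by rewrite (fF z Uz Az).
Qed.

Lemma measurable_tuple d (X : measurableType d) (E : set X) n
    (F : X -> 'rV[R]_n) : measurable E ->
  (forall j, measurable_fun E (fun x => F x 0 j)) ->
  measurable_fun E (fun x => [tuple F x 0 j | j < n] : n.-tuple mR).
Proof.
move=> mE mF.
pose F' x : n.-tuple mR := [tuple ((fun x => F x 0 j) \_ E) x | j < n].
have mF' : measurable_fun setT F'.
  apply/measurable_fun_tnthP => j.
  rewrite (_ : _ \o _ = (fun x => F x 0 j) \_ E).
    by have := mF j => /(measurable_restrictT _ mE).1.
  by apply/funext => x /=; rewrite tnth_mktuple.
apply: (@eq_measurable_fun _ _ _ _ _ F'); last exact: measurable_funTS.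
by move=> x Ex; apply: eq_from_tnth => j; rewrite !tnth_mktuple patchE Ex.
Qed.

(* The domain in [Linfty_sphere_bundle]: [measurable_fun] on it would be vacuous
   were it not measurable. *)
Definition sphere_chart (i : idx M) : set ((m.+1 + m.+1).-tuple mR) :=
  [set z | let y := lsubmx (rowt z) in let v := rsubmx (rowt z) in
     chart_im i y /\ gdot g i y v v = 1].

(** A chart image is the trace of an open set on the half-space, hence Borel; on it the squared norm
    is quadratic in v with continuous coefficients. *)
Lemma measurable_sphere_chart i : measurable (sphere_chart i).
Proof.
set N := (m.+1 + m.+1)%N.
pose Y (z : N.-tuple mR) : 'rV[R]_m.+1 := lsubmx (rowt z).
pose V (z : N.-tuple mR) : 'rV[R]_m.+1 := rsubmx (rowt z).
have mY j : measurable_fun setT (fun z => Y z 0 j).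
  rewrite (_ : (fun z => _) = (@tnth _ mR)^~ (lshift m.+1 j)); first exact: measurable_tnth.
  by apply/funext => z; rewrite /Y !mxE.
have mV j : measurable_fun setT (fun z => V z 0 j).
  rewrite (_ : (fun z => _) = (@tnth _ mR)^~ (rshift m.+1 j)); first exact: measurable_tnth.
  by apply/funext => z; rewrite /V !mxE.
pose E := Y @^-1` chart_im i.
have mE : measurable E.
  have [U oU UE] := coord_image_open i.
  rewrite /E /chart_im UE preimage_setI; apply: measurableI.
    by rewrite -[X in measurable X]setTI; exact: measurable_preimage_open.
  rewrite -[X in measurable X]setTI.
  rewrite (_ : Y @^-1` _ = (fun z => Y z 0 ord0) @^-1` `[0, +oo[%classic); last first.
    by apply/seteqP; split => z /=; rewrite /half_space/= in_itv/= andbT.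
  by apply: mY => //; exact: measurable_itv.
have mG : measurable_fun E (fun z => gdot g i (Y z) (V z) (V z)).
  have gE z : gdot g i (Y z) (V z) (V z) =
      \sum_k (\sum_l V z 0 l * g i (Y z) l k) * V z 0 k.
    by rewrite /gdot mxE; apply: eq_bigr => k _; congr (_ * _); rewrite mxE.
  under eq_fun do rewrite gE.
  apply: measurable_sum => k; apply: measurable_funM; last first.
    exact: measurable_funTS.
  apply: measurable_sum => l; apply: measurable_funM.
    exact: measurable_funTS.
  apply: (measurable_within_continuous_comp _ _ _ _ Y (chart_im i) (fun y => gm g i y l k)) => //.
    by move=> j; exact: measurable_funTS.
  exact: smooth_on_continuous (gm_smooth _ _ _).
rewrite (_ : sphere_chart i = E `&` (fun z => gdot g i (Y z) (V z) (V z)) @^-1` [set 1]).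
  by apply: mG => //; exact: measurable_set1.
by apply/seteqP; split => z [].
Qed.

(** The components in one chart determine all others. This rewrites [W] along a curve in the chart
    form in which it is known to be Borel. *)
Lemma lift_tangentE (z : M * tvec M) i : tangent z -> dom i z.1 ->
  lift_tangent i (coord i z.1) (z.2 i) = z.
Proof.
move=> [tz t0] iz; rewrite /lift_tangent (coordK iz).
case: z tz t0 iz => x v /= tz t0 iz; congr pair; apply/funext => j.
by case: asboolP => [jx|nj]; [rewrite (tz i j)|rewrite t0].
Qed.

(** [D] is cut into countably many relatively open pieces, each mapped into one chart. There
    position and velocity are continuous, being differentiable by the geodesic equation, and the
    Borel chart expression of [W] is composed with them. *)
Lemma geodesic_cmeasurable (D : set R) (c : R -> M * tvec M) (W : M * tvec M -> R[i]) :
  measurable D -> unit_geodesic g D c -> Linfty_sphere_bundle g W ->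
  cmeasurable D (W \o c).
Proof.
move=> mD [[ct cc cd] cS] [_ mW].
have [[s0 Ds0]|D0] := pselect (D !=set0); last first.
  have -> : D = set0 by apply/seteqP; split => // s Ds; case: D0; exists s.
  by split; exact: measurable_fun_set0.
have [a aP] := countable_chart_cover (c s0).1.
pose E n := [set s | D s /\ dom (a n) (c s).1].
have DE : D = \bigcup_n E n.
  apply/seteqP; split => [s Ds|s [n _ []]//].
  by have [n ns] := aP (c s).1; exists n.
have mE n : measurable (E n).
  have /continuousP/(_ _ (dom_open (a n))) oE := cc.
  exact: (@open_measurable_subspace _ D _ mD oE).
have coordcont n j : measurable_fun (E n) (fun s => coord (a n) (c s).1 0 j : R) /\
    measurable_fun (E n) (fun s => (c s).2 (a n) 0 j : R).
  have sub s (u : R -> 'rV[R]_m.+1) : u r @[r --> within D (nbhs s)] --> u s ->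
      (fun r => u r 0 j) @ within (E n) (nbhs s) --> u s 0 j.
    move=> h.
    have hE : u r @[r --> within (E n) (nbhs s)] --> u s.
      move=> V Vu; have hV : nbhs s [set r | D r -> V (u r)] := h V Vu.
      suff : nbhs s [set r | E n r -> V (u r)] by [].
      by apply: filterS hV => r Vr [Dr _]; exact: Vr.
    exact: (cvg_comp _ (fun v : 'rV[R]_m.+1 => v 0 j) hE
      (@matrix_normedtype.coord_continuous _ _ _ 0 j (u s))).
  split; apply: subspace_continuous_measurable_fun => //;
    apply/subspace_continuousP => s [Ds ns];
    have [d1 d2] := cd (a n) s Ds ns.
  - exact: (sub s (fun r => coord (a n) (c r).1) (deriv_on_continuous _ _ _ _ _ d1)).
  - exact: (sub s (fun r => (c r).2 (a n)) (deriv_on_continuous _ _ _ _ _ d2)).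
pose F n s : 'rV[R]_(m.+1 + m.+1) := row_mx (coord (a n) (c s).1) ((c s).2 (a n)).
have mF n j : measurable_fun (E n) (fun s => F n s 0 j).
  rewrite -(splitK j); case: (fintype.split j) => k /=.
    by under eq_fun do rewrite row_mxEl; exact: (coordcont n k).1.
  by under eq_fun do rewrite row_mxEr; exact: (coordcont n k).2.
pose Z n s : (m.+1 + m.+1).-tuple mR := [tuple F n s 0 j | j < m.+1 + m.+1].
have mZ n : measurable_fun (E n) (Z n) by exact: measurable_tuple.
have rowZ n s : rowt (Z n s) = F n s.
  by apply/rowP => j; rewrite mxE tnth_mktuple.
have ZD n : [set Z n s | s in E n] `<=` sphere_chart (a n).
  move=> _ [s [Ds ns] <-]; rewrite /sphere_chart/= rowZ row_mxKl row_mxKr; split.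
    by exists (c s).1.
  by have [_] := cS s Ds; exact.
have cE n s : E n s -> W (c s) =
    W (lift_tangent (a n) (lsubmx (rowt (Z n s))) (rsubmx (rowt (Z n s)))).
  move=> [Ds ns]; rewrite rowZ row_mxKl row_mxKr lift_tangentE//.
  exact: ct.
rewrite DE; split; apply/measurable_fun_bigcup => // n.
- apply: (@eq_measurable_fun _ _ _ _ _ ((fun z =>
    Re (W (lift_tangent (a n) (lsubmx (rowt z)) (rsubmx (rowt z))))) \o Z n)).
    by move=> s /set_mem Es /=; rewrite -(cE n s Es).
  exact: (measurable_comp (measurable_sphere_chart (a n)) (ZD n) (mW (a n)).1 (mZ n)).
- apply: (@eq_measurable_fun _ _ _ _ _ ((fun z =>
    Im (W (lift_tangent (a n) (lsubmx (rowt z)) (rsubmx (rowt z))))) \o Z n)).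
    by move=> s /set_mem Es /=; rewrite -(cE n s Es).
  exact: (measurable_comp (measurable_sphere_chart (a n)) (ZD n) (mW (a n)).2 (mZ n)).
Qed.

Lemma xray_time_fourier_eq0 (W : M * tvec M -> R[i]) (S : R -> M -> R[i])
    (z : M * tvec M) (eta : R) :
  Linfty_sphere_bundle g W -> Bochner_L1 S ->
  {ae mu, forall t, LW g W S t z = 0} ->
  xray g (exp_weight g W eta) (time_fourier S eta) z = 0.
Proof.
move=> WL BS S0.
set P := [set q : R * (R -> M * tvec M) | [/\ 0 <= q.1, maximal_geodesic g `[0, q.1] q.2,
  q.2 0 = z & bdry (q.2 q.1).1]].
have [exP|nP] := pselect (exists q, P q); last first.
  have tau0 : exit_time g z = 0.
    by rewrite /exit_time /exit_pair xgetPN// => q Pq; apply: nP; exists q.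
  by rewrite /xray tau0 set_itv1; apply: complex_eq0; rewrite /= Rintegral_set1.
have [tau_ge0 [_ _ geo _] _ _] : P (exit_pair g z) by exact: xgetPex.
set tau := exit_time g z; set c := flow g z.
have {}geo : unit_geodesic g `[0, tau] c := geo.
have {}tau_ge0 : 0 <= tau := tau_ge0.
(* Clamping extends the geodesic measurably to the whole line. The values outside [0, tau] do not
   matter, as the weight is extended by 0. *)
pose clamp (s : R) : R := Num.max 0 (Num.min s tau).
have clampD s : `[0, tau]%classic (clamp s).
  by rewrite /= in_itv/= /clamp le_max lexx/= ge_max tau_ge0/= ge_min lexx orbT.
have clampE s : `[0, tau]%classic s -> clamp s = s.
  rewrite /= in_itv/= => /andP[s0 st].
  by rewrite /clamp (min_idPl st); exact/max_idPr.
have mclamp : measurable_fun (setT : set R) (clamp : R -> R).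
  have mmin := @measurable_minr _ _ R setT idfun (fun=> tau)
    (@measurable_id _ _ _) (measurable_cst tau).
  exact: (@measurable_maxr _ _ R setT (fun=> 0 : R) _ (measurable_cst (0 : R)) mmin).
have mD : measurable (`[0, tau]%classic : set R) by exact: measurable_itv.
pose p s := (c (clamp s)).1.
have mp (f : M -> R[i]) : ccontinuous f -> cmeasurable setT (f \o p).
  have [_ cc _] := geo.1.
  have mf (h : M -> R) : continuous h -> measurable_fun setT (h \o p).
    move=> ch; apply: (@measurable_comp _ _ _ _ _ _ `[0, tau]%classic
        (fun s => h (c s).1) setT clamp) => //.
      by move=> _ [s _ <-]; exact: clampD.
    apply: subspace_continuous_measurable_fun => // s.
    by apply: continuous_comp; [exact: cc|exact: ch].
  by move=> [f1 f2]; split; [exact: (mf _ f1)|exact: (mf _ f2)].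
pose w s := if `[< `[0, tau]%classic s >] then W (c s) else 0.
have wE s : `[0, tau]%classic s -> w s = W (c s) by move=> Ds; rewrite /w asboolT.
have w0 s : ~ `[0, tau]%classic s -> w s = 0 by move=> Ds; rewrite /w asboolF.
have mw : cmeasurable setT w.
  have [m1 m2] := geodesic_cmeasurable _ _ W mD geo WL.
  have E (q : R[i] -> R) : q 0 = 0 -> (fun s => q (w s)) =
      (fun s => q (W (c s))) \_ `[0, tau]%classic.
    move=> q0; apply/funext => s; rewrite patchE; case: ifPn => [/set_mem Ds|Ds].
      by rewrite wE.
    by rewrite w0//; move: Ds; rewrite notin_setE.
  split.
  - by rewrite (E (fun z => Re z))//; exact: (measurable_restrictT _ mD).1 m1.
  - by rewrite (E (fun z => Im z))//; exact: (measurable_restrictT _ mD).1 m2.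
have [C WC] := WL.1.
(* The absolute value keeps the bound valid off [0, tau], where [w] is 0. *)
have wC s : normc (w s) <= `|C|.
  have [Ds|Ds] := pselect (`[0, tau]%classic s); last first.
    by rewrite w0// ComplexField.Normc.normc0.
  by rewrite wE//; apply: le_trans (WC _ (geo.2 s Ds)) (ler_norm _).
have [e dense_e] := cmanifold_dense_sequence z.1.
have S0' : {ae mu, forall t, cintegral setT (fun s => S (t + s) (p s) * w s) = 0}.
  have FF := ae_filter_ringOfSetsType mu.
  apply: filterS S0 => t <-; apply/esym/cintegral_mkcond => s Ds.
    by rewrite wE// /p clampE.
  by rewrite w0// mulr0.
rewrite -[RHS](cintegral_time_fourier S BS e dense_e p w _ tau mp mw wC w0 S0' eta).
apply: cintegral_mkcond => s Ds.
  by rewrite wE// /p clampE.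
by rewrite w0// mulr0 mul0r.
Qed.

(** Time is the first coordinate in [ae_time_inward], so [lebn_negligible_section] applies chart by
    chart. *)
Lemma ae_inward_section (P : R -> M * tvec M -> Prop) (Q : M * tvec M -> Prop) :
  (forall z, {ae mu, forall t, P t z} -> Q z) ->
  ae_time_inward g P -> ae_inward g Q.
Proof.
move=> PQ aeP i.
have [B [mB B0 AB]] := lebn_negligible_section _ _ (aeP i).
exists B; split => // z [iz nQ]; apply: AB => /= aeA; apply: nQ; apply: PQ.
have FF := ae_filter_ringOfSetsType mu.
apply: filterS aeA => t nA; apply: contrapT => nP; apply: nA.
rewrite (_ : [tuple of behead [tuple of t :: z]] = z) ?theadE//.
exact: val_inj.
Qed.

End geodesics.

Theorem theoremA3 (R : realType) (m : nat) (dim_ge2 : (2 <= m.+1)%N)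
    (M : cmanifold R m) (g : riemannian M)
    (trapping_free : non_trapping g) (convex : strictly_convex_boundary g)
    (W : M * tvec M -> R[i]) (W_Linfty : Linfty_sphere_bundle g W)
    (W_nonvanishing : ae_sphere_bundle g (fun z => W z <> 0))
    (injective : forall eta : R, xray_injective g (exp_weight g W eta))
    (S : R -> M -> R[i])
    (S_Linfty : exists C : R,
       ae_time_interior (fun t x => ComplexField.Normc.normc (S t x) <= C))
    (S_L1 : Bochner_L1 S)
    (LWS_eq0 : ae_time_inward g (fun t z => LW g W S t z = 0)) :
  {ae @lebesgue_measure R, forall t, forall x : M, S t x = 0}.
Proof.
(* A dense sequence requires a point; on an empty manifold the conclusion is vacuous. *)
have [[x0 _]|noM] := pselect (exists x : M, True); last first.
  by apply: aeW => t x; case: noM; exists x.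
have [e dense_e] := cmanifold_dense_sequence x0.
apply: (time_fourier_inj S S_L1 e dense_e) => eta.
apply: (injective eta).
  apply: (ccontinuous_time_fourier S S_L1 e dense_e) => x.
  exact: cmanifold_first_countable.
apply: ae_inward_section LWS_eq0 => z; exact: xray_time_fourier_eq0.
Qed.
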